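(* Let $k\ge1$ and $\zeta=e^{2\pi i j/k}$ with $\gcd(j,k)=1$. Let $v_k(n):=\max_{w\in k\mathcal{L}_n}\Phi^k_w$ and $v(n):=\max_{w\in\mathcal{L}_n}\mathfrak{S}_w(1,\ldots,1)$. Then the limit $\lim_{n\to\infty}\frac{\log_2 v_k(n)}{n^2}$ exists and \[\lim_{n\to\infty}\frac{\log_2 v_k(n)}{n^2}=\frac1k\lim_{n\to\infty}\frac{\log_2 v(n)}{n^2}=\frac{\gamma}{k\log 2}.\]
   Context: $\mathfrak{S}_w$ is the Schubert polynomial, $\Phi^k_w:=|\mathfrak{S}_w(1,\zeta,\zeta^2,\ldots)|$. For $u\in S_a$, $v\in S_b$, $u\times v:=(u_1,\ldots,u_a,v_1+a,\ldots,v_b+a)$. $\mathcal{L}_n$ is the set of layered permutations $w_0(b_1)\times\cdots\times w_0(b_t)\in S_n$ ($b_i$ positive integers, $w_0(p)=(p,\ldots,1)$). For $N=kb+r$, $0\le r<k$, $w_0^k(N)=(N-k+1,\ldots,N,\;N-2k+1,\ldots,N-k,\;\ldots,\;r+1,\ldots,r+k,\;1,\ldots,r)$; $k\mathcal{L}_n$ is the set of $k$-multi-layered permutations $w^k_0(kb_1)\times\cdots\times w^k_0(kb_{t-1})\times w^k_0(kb_t+r)\in S_n$ with $b_i$ positive integers, $n=k(b_1+\cdots+b_t)+r$, $r=n\bmod k$. The constant $\gamma\approx0.2032558981$ is the universal constant with $\lim_{n\to\infty}\frac{\log v(n)}{n^2}=\gamma$ (natural log), which exists by a theorem of Morales, Pak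 and Panova. *)

(* Defs.v *)
From HB Require Import structures.
From mathcomp Require Import all_boot all_order all_algebra all_fingroup.
From mathcomp Require mpoly.

Set Implicit Arguments.
Unset Strict Implicit.
Unset Printing Implicit Defensive.

Import Order.TTheory GRing.Theory Num.Theory.

(* The notations of mpoly and of mathcomp-analysis cannot be active together:
   mpoly is imported in this module only, and analysis after it. *)
Module Schubert.
Import mpoly.
Local Open Scope ring_scope.

Section Schubert.
Variable n : nat.
Implicit Types (i j : 'I_n) (w : 'S_n) (f g : {mpoly int[n]}).

(* 'X_i^a 'X_j^b |-> ('X_i^a 'X_j^b - 'X_j^a 'X_i^b) / ('X_i - 'X_j), written
   out as a geometric sum (one of the two sums is always empty). *)
Definition divdiff_pow i j (a b : nat) : {mpoly int[n]} :=
  \sum_(b <= c < a) 'X_i ^+ c * 'X_j ^+ (a + b - c.+1)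
  - \sum_(a <= c < b) 'X_i ^+ c * 'X_j ^+ (a + b - c.+1).

(* The divided difference (f - f(.., x_j, .., x_i, ..)) / (x_i - x_j);
   see divdiffP. *)
Definition divdiff i j f : {mpoly int[n]} :=
  \sum_(m <- msupp f)
    f@_m *: ((\prod_(l < n | (l != i) && (l != j)) 'X_l ^+ m l)
             * divdiff_pow i j (m i) (m j)).

Lemma divdiff_powP i j (a b : nat) :
  ('X_i - 'X_j) * divdiff_pow i j a b
  = 'X_i ^+ a * 'X_j ^+ b - 'X_j ^+ a * 'X_i ^+ b.
Proof.
have key (x y : {mpoly int[n]}) p q : (q <= p)%N ->
  (x - y) * (\sum_(q <= c < p) x ^+ c * y ^+ (p + q - c.+1))
  = x ^+ p * y ^+ q - y ^+ p * x ^+ q.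
  move=> qp; rewrite -(subnK qp); move: (p - q)%N => d.
  rewrite mulr_sumr.
  rewrite (@telescope_sumr_eq _ q (d + q)
    (fun c => x ^+ c * y ^+ (d + q + q - c))); first last.
  - move=> c /andP[qc cd]; rewrite mulrBl mulrA -exprS.
    congr (_ - _); rewrite mulrCA -exprS; congr (_ * _ ^+ _).
    by rewrite subnSK // (leq_trans cd) // leq_addr.
  - by rewrite leq_addl.
  by rewrite addKn addnK [x ^+ q * _]mulrC.
rewrite /divdiff_pow; case: (leqP b a) => ab.
  by rewrite [X in _ * (_ - X)]big_geq // subr0 key.
rewrite [X in _ * (X - _)]big_geq; last exact: ltnW.
rewrite sub0r mulrN addnC key; last exact: ltnW.
by rewrite opprB [X in X - _]mulrC [X in _ - X]mulrC.
Qed.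

Lemma divdiffP i j f :
  i != j -> ('X_i - 'X_j) * divdiff i j f = f - msym (tperm i j) f.
Proof.
move=> ij; rewrite /divdiff mulr_sumr.
have -> : f - msym (tperm i j) f = \sum_(m <- msupp f)
    (f@_m *: 'X_[m] - msym (tperm i j) (f@_m *: 'X_[m])).
  by rewrite sumrB -raddf_sum /= -mpolyE.
apply: eq_bigr => m _; rewrite linearZ /= -scalerBr -scalerAr; congr (_ *: _).
rewrite mulrCA divdiff_powP (mpolyXE_id _ m) rmorph_prod /=.
have E (h : 'I_n -> {mpoly int[n]}) : \prod_l h l
   = (\prod_(l < n | (l != i) && (l != j)) h l) * (h i * h j).
  rewrite (bigD1 i) //= (bigD1 j) 1?eq_sym //= mulrA mulrC.
  by congr (_ * _).
rewrite [in RHS]E [X in _ = _ - X]E mulrBr; congr (_ - _).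
have sX l : msym (tperm i j) 'X_l = 'X_(tperm i j l) :> {mpoly int[n]}.
  by rewrite msymX /=; congr mpolyX; apply/mnmP => r;
     rewrite !mnmE -(inj_eq (@perm_inj _ (tperm i j))) permKV.
congr (_ * _).
  apply: eq_bigr => l /andP[li lj]; rewrite rmorphXn /= sX.
  by rewrite tpermD // eq_sym.
by rewrite !rmorphXn /= !sX tpermL tpermR.
Qed.

(* With N large enough (see schubert), S_w for w with one-line word
   w_1 ... w_n (values and variables numbered from 0): S_{w_0} is the
   staircase monomial and S_w = d_i S_{w s_i} for an ascent w_i < w_{i+1}.
   [pick] selects some ascent; since the operators d_i satisfy the braid
   relations, the result does not depend on it.  Permutations compose from
   left to right, so w s_i is tperm i (i + 1) * w. *)
Fixpoint schubert_rec (N : nat) w : {mpoly int[n]} :=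
  match N, [pick ij : 'I_n * 'I_n |
             (ij.2 == ij.1.+1 :> nat) && (w ij.1 < w ij.2)%N] with
  | N'.+1, Some ij =>
      divdiff ij.1 ij.2 (schubert_rec N' (tperm ij.1 ij.2 * w)%g)
  | _, _ => \prod_(i < n) 'X_i ^+ (n - i.+1)
  end.

(* 'C(n, 2) steps suffice: each step adds an inversion. *)
Definition schubert w : {mpoly int[n]} := schubert_rec 'C(n, 2) w.

(* S_w(x_1, x_2, ...), where x_(i+1) is h i. *)
Definition schubert_eval (A : comNzRingType) (h : nat -> A) w : A :=
  mmap intr (fun i : 'I_n => h i) (schubert w).

End Schubert.
End Schubert.

From mathcomp Require Import all_classical all_reals all_analysis.
From mathcomp Require Import complex.

Import numFieldNormedType.Exports.
Local Open Scope classical_set_scope.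
Local Open Scope ring_scope.

(* One-line words are lists with entries in 1 .. n. *)
Definition oneline (n : nat) (w : 'S_n) : seq nat :=
  [seq (w i).+1 | i <- enum 'I_n].

Definition direct_prod (u v : seq nat) : seq nat :=
  u ++ [seq (x + size u)%N | x <- v].

Definition w0 (p : nat) : seq nat := rev (iota 1 p).

(* N-k+1, ..., N, N-2k+1, ..., N-k, ..., r+1, ..., r+k, 1, ..., r *)
Definition w0k (k N : nat) : seq nat :=
  flatten [seq iota (N - k * i).+1 k | i <- iota 1 (N %/ k)]
  ++ iota 1 (N %% k).

Definition layered (n : nat) (w : 'S_n) : Prop :=
  exists bs : seq nat,
    [/\ all (fun b => 0 < b)%N bs, sumn bs = n
      & oneline w = foldr direct_prod [::] [seq w0 b | b <- bs]].

(* bs lists b_1, ..., b_(t-1), and b is b_t. *)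
Definition multi_layered (k n : nat) (w : 'S_n) : Prop :=
  exists (bs : seq nat) (b : nat),
    [/\ all (fun b => 0 < b)%N bs, (0 < b)%N,
        n = (k * (sumn bs + b) + n %% k)%N
      & oneline w = foldr direct_prod (w0k k (k * b + n %% k))
                          [seq w0k k (k * b') | b' <- bs]].

Section Specializations.
Variable R : realType.

Definition log2 (x : R) : R := ln x / ln 2.

(* exp(2 pi i j / k) *)
Definition zeta (k : nat) (j : int) : R[i] :=
  let t := 2 * pi * j%:~R / k%:R in (cos t +i* sin t)%C.

Definition Phi (k : nat) (j : int) (n : nat) (w : 'S_n) : R :=
  Normc.normc (Schubert.schubert_eval (fun i => zeta k j ^+ i) w).

(* The default value 0 is never the maximum unless the set is empty, i.e.
   n < k: a modulus is nonnegative. *)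
Definition vk (k : nat) (j : int) (n : nat) : R :=
  \big[Num.max/0]_(w : 'S_n | `[< multi_layered k w >]) Phi k j w.

(* The default value 0 is harmless: the identity is layered, of value 1. *)
Definition v (n : nat) : R :=
  \big[Num.max/0]_(w : 'S_n | `[< layered w >])
    Schubert.schubert_eval (fun=> 1 : R) w.

Definition gamma : R := limn (fun n : nat => ln (v n) / n%:R ^+ 2).

End Specializations.

(* Main.v *)
(* Schubert side.  Divided differences satisfy the braid relations, so S_w may be
   computed along any chain of ascents.  Uniqueness (a polynomial killed by all
   divided differences and free of the last variable is constant) gives
   S_(u x v) = S_u S_(1 x v), which reduces everything to 1^m x w0k(N).  The latter
   is reached from a dominant permutation, whose Schubert polynomial is a monomial,
   by divided differences that raise the flags of a determinant of complete
   symmetric polynomials one row at a time; this is a flagged Jacobi-Trudi formula.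

   Root of unity.  When q is a primitive k-th root of unity,
   h_(kR+c-a)(1, q, ..., q^(kS+a)) = T(a,c) binom(R+S, S) with T unitriangular, so
   after reordering rows and columns the determinant for 1^(kM) x w0k(kb+r) is block
   triangular, and its modulus is F(M,b)^(k-r) F(M,b+1)^r, where F(M,b) is the value
   at 1 for 1^M x w0(b).  Hence, with n = kN + r,
     k log v(N) <= log v_k(n) <= k log v(N+1).

   Existence of the limit.  Column operations in the style of Krattenthaler give
   F(M,b) = prod_(c<b) prod_(l<c) (1 + 2M/(2c-l)).  Comparing the factors at scales
   1 and c yields log v(cn) >= c^2 (log v(n) - n log(1+2n)), and log v(n) <= 2n^2, so
   log v(n)/n^2 converges. *)
Require Import Defs.
From mathcomp Require Import all_boot all_order all_algebra all_fingroup.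
From mathcomp Require Import zify ring lra.
From mathcomp Require mpoly.

Set Implicit Arguments.
Unset Strict Implicit.
Unset Printing Implicit Defensive.

Import Order.TTheory GRing.Theory Num.Theory.

(** * One-line words *)

(** The root of unity can be exploited because every block starts at an offset divisible by [k]: the
    remainder [r] occurs in the last block only. A determinant entry in row ki + a then splits into
    a factor that sees only residues mod [k] and one that sees only quotients. In the last block the
    shift by [r] wraps [r] of the [k] residue classes of columns around; their quotients rise by
    one. This is the source of the [r] factors F(M,b+1) and of the N + 1 in the upper bound.

    Since [gamma] is defined by [limn], it carries no information until log v(n)/n^2 is known to
    converge, so this convergence has to be proved along the way. An argument by concatenation in
    the manner of Fekete is adapted to linear growth. For quadratic growth, a layered permutation is
    compared with its dilation, all blocks multiplied by c: each factor of the product formula then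
    corresponds to c^2 factors of nearly the same size. *)

Section Oneline.
Variable n : nat.
Implicit Types (w : 'S_n) (s : seq nat).

Lemma size_oneline w : size (oneline w) = n.
Proof. by rewrite size_map size_enum_ord. Qed.

Lemma nth_oneline w (i : 'I_n) : nth 0 (oneline w) i = (w i).+1.
Proof. by rewrite (nth_map i) ?size_enum_ord // nth_ord_enum. Qed.

Lemma oneline_onto s : perm_eq s (iota 1 n) -> exists w, oneline w = s.
Proof.
move=> sP; have sn : size s = n by rewrite (perm_size sP) size_iota.
have su : uniq s by rewrite (perm_uniq sP) iota_uniq.
have sb (i : 'I_n) : 0 < nth 0 s i < n.+1.
  have : nth 0 s i \in s by rewrite mem_nth // sn.
  by rewrite (perm_mem sP) mem_iota add1n.
have lt (i : 'I_n) : (nth 0 s i).-1 < n by have := sb i; lia.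
have inj : injective (fun i : 'I_n => Ordinal (lt i)).
  move=> i j /(congr1 val) /= ij; apply: val_inj; apply/eqP.
  rewrite -(nth_uniq 0 _ _ su) ?sn ?ltn_ord //; apply/eqP.
  by have := sb i; have := sb j; move: ij => /=; lia.
exists (perm inj); apply: (@eq_from_nth _ 0); first by rewrite size_oneline sn.
move=> i; rewrite size_oneline => ilt; rewrite (nth_oneline _ (Ordinal ilt)) permE /=.
by have := sb (Ordinal ilt) => /=; lia.
Qed.

Lemma oneline_tperm (i j : 'I_n) w s1 s2 a b :
  j = i.+1 :> nat -> size s1 = i -> oneline w = s1 ++ a :: b :: s2 ->
  oneline (tperm i j * w) = s1 ++ b :: a :: s2.
Proof.
move=> ij s1i e; have e1 := congr1 size e.
rewrite size_oneline size_cat /= in e1.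
apply: (@eq_from_nth _ 0); first by rewrite size_oneline size_cat.
move=> k; rewrite size_oneline => kn; rewrite (nth_oneline _ (Ordinal kn)) permM.
rewrite -nth_oneline e !nth_cat s1i.
case: tpermP => [/(congr1 val)/= ->|/(congr1 val)/= ->|/eqP + /eqP].
- by rewrite ij ltnn ltnNge leqnSn subSnn subnn.
- by rewrite ij ltnn ltnNge leqnSn subSnn subnn.
rewrite -!val_eqE /= ij => /eqP ki /eqP kj; case: ltnP => // ik.
by case E: (k - i)%N => [|[|l]] //; lia.
Qed.
End Oneline.

(** * Words of direct products and of multi-layered permutations *)

Section Words.
Implicit Types (s t u v : seq nat) (m n k b r : nat).

Definition is_word s := perm_eq s (iota 1 (size s)).

Lemma map_addn_iota m a c : [seq (x + m)%N | x <- iota a c] = iota (a + m) c.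
Proof. by rewrite addnC iotaDl; apply: eq_map => x; rewrite addnC. Qed.

Lemma is_word_direct_prod u v : is_word u -> is_word v -> is_word (direct_prod u v).
Proof.
rewrite /is_word /direct_prod => uP vP; rewrite size_cat size_map iotaD add1n.
by apply: perm_cat => //; rewrite -add1n -map_addn_iota perm_map.
Qed.

Lemma is_word_foldr t ss : all is_word ss -> is_word t ->
  is_word (foldr direct_prod t ss).
Proof. by move=> + tP; elim: ss => //= s ss IH /andP[sP /IH];
  apply: is_word_direct_prod. Qed.

Lemma is_word_oneline n (w : 'S_n) : perm_eq (oneline w) (iota 1 n).
Proof.
apply: uniq_perm => [||x].
- by rewrite map_inj_uniq ?enum_uniq // => i j [] /val_inj; apply: perm_inj.
- exact: iota_uniq.
rewrite mem_iota add1n; apply/mapP/andP => [[i _ ->]|[x0 xn]];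
  first by rewrite !ltnS ltn_ord.
have xn' : x.-1 < n by lia.
by exists ((w^-1)%g (Ordinal xn')); rewrite ?mem_enum // permKV /=; lia.
Qed.

Lemma perm_eq_blocks k N b : k * b <= N ->
  perm_eq (flatten [seq iota (N - k * i).+1 k | i <- iota 1 b])
          (iota (N - k * b).+1 (k * b)).
Proof.
elim: b => [|b IH]; first by rewrite muln0.
rewrite mulnS => kN; rewrite -[b.+1]addn1 iotaD map_cat flatten_cat /= cats0 add1n.
rewrite perm_catC mulnS iotaD perm_cat2l.
have -> : (N - (k + k * b)).+1 + k = (N - k * b).+1 by lia.
by apply: IH; lia.
Qed.

Lemma w0kE k b r : r < k -> w0k k (k * b + r) =
  flatten [seq iota (k * b + r - k * i).+1 k | i <- iota 1 b] ++ iota 1 r.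
Proof.
move=> rk; rewrite /w0k [k * b]mulnC divnMDl; last by lia.
by rewrite divn_small // addn0 modnMDl modn_small.
Qed.

Lemma size_w0k k b r : r < k -> size (w0k k (k * b + r)) = k * b + r.
Proof.
move=> rk; rewrite w0kE // size_cat size_iota size_flatten /shape -map_comp.
rewrite (eq_map (g := fun=> k)); last by move=> i /=; rewrite size_iota.
by congr addn; elim: b {rk} (1) => [|b IH] j /=; rewrite ?muln0 // IH mulnS.
Qed.

Lemma is_word_w0k k b r : r < k -> is_word (w0k k (k * b + r)).
Proof.
move=> rk; rewrite /is_word size_w0k // w0kE // perm_catC addnC iotaD perm_cat2l.
rewrite addnC; have -> : 1 + r = (k * b + r - k * b).+1 by rewrite addKn.
by apply: perm_eq_blocks; apply: leq_addr.
Qed.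

(** This makes layered permutations the case k = 1, q = 1 of the multi-layered computation, so [v]
    and [vk] are evaluated by the same formula. *)
Lemma w0E p : w0 p = w0k 1 p.
Proof.
have := @w0kE 1 p 0 isT; rewrite mul1n !addn0 cats0 => ->.
have -> : [seq iota (p - 1 * i).+1 1 | i <- iota 1 p] =
          [seq [:: x] | x <- [seq (p - i).+1 | i <- iota 1 p]].
  by rewrite -map_comp; apply: eq_map => i /=; rewrite mul1n.
rewrite flatten_seq1; apply: (@eq_from_nth _ 0) => [|i]; rewrite size_rev ?size_map //.
rewrite size_iota => ip;
  rewrite nth_rev ?size_iota // nth_iota ?(nth_map 0) ?size_iota //; last by lia.
by rewrite nth_iota //; lia.
Qed.

Lemma iota_blocks k b : iota 0 (k * b) = flatten [seq iota (k * i) k | i <- iota 0 b].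
Proof.
elim: b => [|b IH]; first by rewrite muln0.
by rewrite mulnS addnC iotaD IH -[b.+1]addn1 iotaD map_cat flatten_cat /= cats0.
Qed.
End Words.

Local Open Scope ring_scope.

(** * Complete symmetric polynomials *)

Section CompleteSymmetric.
Variable A : comNzRingType.
Implicit Types (x y : nat -> A) (s r : nat) (z : int).

Fixpoint hsym x s r : A :=
  if s is s'.+1 then \sum_(c < r.+1) x s' ^+ c * hsym x s' (r - c)
  else (r == 0%N)%:R.

(* h_z(x_0, ..., x_(s-1)), extended by 0 to negative degrees. *)
Definition hz x s z : A := if z is Posz r then hsym x s r else 0.

Lemma hz_lt0 x s z : z < 0 -> hz x s z = 0.
Proof. by case: z. Qed.

Lemma hz0 x z : hz x 0 z = (z == 0)%:R.
Proof. by case: z. Qed.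

Lemma hzS x s z : hz x s.+1 z = hz x s z + x s * hz x s.+1 (z - 1).
Proof.
case: z => [[|r]|r].
- by rewrite /= big_ord_recl big_ord0 mul1r addr0 mulr0 addr0.
- have -> : r.+1%:Z - 1 = r by lia.
  rewrite /= big_ord_recl expr0 mul1r subn0 mulr_sumr; congr (_ + _).
  by apply: eq_bigr => c _; rewrite exprS mulrA subSS.
- by rewrite [in RHS]hz_lt0 ?mulr0 ?addr0 //; lia.
Qed.

Arguments hz : simpl never.

(** The induction for identities between [hz]: they are trivial in negative degrees, and [hzS]
    lowers the degree by one. *)
Lemma int_ind_ge0 (P : int -> Prop) :
  (forall z, z < 0 -> P z) -> (forall z, P (z - 1) -> P z) -> forall z, P z.
Proof.
move=> P0 PS; case=> [r|r]; last exact: P0.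
elim: r => [|r IH]; apply: PS; first exact: P0.
by have -> : r.+1%:Z - 1 = r by lia.
Qed.

Lemma eq_hz x y s z : (forall i, (i < s)%N -> x i = y i) -> hz x s z = hz y s z.
Proof.
elim: s z => [|s IH] z xy; first by rewrite !hz0.
elim/int_ind_ge0: z => z H; first by rewrite !hz_lt0.
by rewrite hzS [RHS]hzS H xy // IH // => i si; rewrite xy // ltnW.
Qed.

(** The last two variables enter only through their sum and product: [E] is the recurrence given by
    the factor 1 - (u + u')t + uu't^2 of the generating function. Being of order two, it requires an
    induction on two consecutive degrees. *)
Lemma hz_swap2 x y s z : (forall i, (i < s)%N -> x i = y i) ->
  x s = y s.+1 -> x s.+1 = y s -> hz x s.+2 z = hz y s.+2 z.
Proof.
move=> xy xs xs1.
have E u v : hz u s.+2 v = hz u s v + (u s + u s.+1) * hz u s.+2 (v - 1)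
    - u s * u s.+1 * hz u s.+2 (v - 1 - 1).
  have e := hzS u s.+1 (v - 1); rewrite hzS [hz u s.+1 v]hzS.
  have -> : hz u s.+1 (v - 1) = hz u s.+2 (v - 1) - u s.+1 * hz u s.+2 (v - 1 - 1).
    by rewrite e addrK.
  by ring.
suff: hz x s.+2 z = hz y s.+2 z /\ hz x s.+2 (z - 1) = hz y s.+2 (z - 1) by case.
elim/int_ind_ge0: z => z H; first by rewrite !hz_lt0 //; lia.
case: H => H1 H2; split=> //.
by rewrite E [RHS]E H1 H2 xs xs1 (eq_hz _ xy); ring.
Qed.

Lemma hz_swap x y s t z : (forall i, i != s -> i != s.+1 -> x i = y i) ->
  x s = y s.+1 -> x s.+1 = y s -> (s.+1 < t)%N -> hz x t z = hz y t z.
Proof.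
move=> xy xs xs1; elim: t z => // t IH z; rewrite ltnS leq_eqVlt => /orP[/eqP <-|st].
  by apply: hz_swap2 => // i si; apply: xy; lia.
elim/int_ind_ge0: z => z H; first by rewrite !hz_lt0.
by rewrite hzS [RHS]hzS H IH // (xy t) //; lia.
Qed.

Lemma hz_shift x s z :
  hz x s.+1 z - x 0%N * hz x s.+1 (z - 1) = hz (x \o succn) s z.
Proof.
elim: s z => [|s IH] z; first by rewrite hzS !hz0 addrK.
elim/int_ind_ge0: z => z H; first by rewrite !hz_lt0 ?mulr0 ?subr0 //; lia.
rewrite [RHS]hzS -H -IH /= hzS [hz x s.+2 (z - 1)]hzS; ring.
Qed.

(** Subtracting [x 0] times the preceding column from each column removes [x 0] from the variables
    ([hz_shift]). The first row is left with its first entry only, and the minor has the same form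
    in the remaining variables. *)
Lemma det_hz x (p : nat) (d : nat -> nat) :
  \det (\matrix_(a < p, c < p) hz x a.+1 ((d a)%:Z - a%:Z + c%:Z))
  = \prod_(a < p) x a ^+ d a.
Proof.
elim: p x d => [|p IH] x d; first by rewrite det_mx00 big_ord0.
set M := \matrix_(a, c) _.
pose U : 'M[A]_p.+1 :=
  \matrix_(l, c) (if l == c then 1 else if l.+1 == c then - x 0%N else 0).
have detU : \det U = 1.
  rewrite -det_tr det_trig; last first.
    apply/is_trig_mxP => i j ij; rewrite !mxE; case: eqP => [e|_];
      last by case: eqP => //; lia.
    by rewrite e ltnn in ij.
  by rewrite big1 // => i _; rewrite !mxE eqxx.
transitivity (\det (M *m U)); first by rewrite det_mulmx detU mulr1.
have MU0 a : (M *m U) a ord0 = M a ord0.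
  rewrite mxE (bigD1 ord0) //= big1 ?addr0 => [|l l0];
    first by rewrite [U _ _]mxE eqxx mulr1.
  by rewrite [U _ _]mxE (negPf l0) mulr0.
have MUS a (c : 'I_p) : (M *m U) a (lift ord0 c) =
    M a (lift ord0 c) - x 0%N * M a (widen_ord (leqnSn p) c).
  rewrite mxE (bigD1 (lift ord0 c)) //= (bigD1 (widen_ord (leqnSn p) c)) //=; last first.
    by rewrite -val_eqE /= /bump; lia.
  rewrite big1 ?addr0 => [|l /andP[l1 l2]]; last first.
    rewrite [U _ _]mxE (negPf l1); case: eqP => [e|_]; last by rewrite mulr0.
    by move: l2; rewrite -val_eqE /=; move: e; rewrite /= /bump; lia.
  rewrite ![U _ _]mxE eqxx mulr1 -val_eqE /= /bump /= add1n eqxx.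
  by rewrite ltn_eqF // mulrN mulrC.
rewrite (expand_det_row _ ord0) (bigD1 ord0) //= big1 ?addr0; last first.
  move=> c c0; have [c' ->] : exists c' : 'I_p, c = lift ord0 c'.
    by case: (unliftP ord0 c) c0 => [c' -> _|->]; [exists c'|rewrite eqxx].
  rewrite MUS !mxE /= /bump /= add1n.
  have -> : (d 0%N)%:Z - 0%:Z + c'%:Z = (d 0%N)%:Z - 0%:Z + c'.+1%:Z - 1 by lia.
  rewrite hz_shift hz0; case: eqP => [e|_]; last by rewrite mul0r.
  by exfalso; lia.
rewrite MU0 mxE big_ord_recl /=.
have -> : hz x 1 ((d 0%N)%:Z - 0%:Z + 0%:Z) = x 0%N ^+ d 0%N.
  have -> : (d 0%N)%:Z - 0%:Z + 0%:Z = d 0%N by lia.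
  elim: (d 0%N) => [|e IHe]; first by rewrite hzS !hz0 hz_lt0 // mulr0 addr0.
  rewrite hzS hz0 add0r exprS -IHe; congr (_ * hz _ _ _); lia.
congr (_ * _); rewrite /cofactor addn0 expr0 mul1r -[RHS](IH (x \o succn) (d \o succn)).
congr (\det _); apply/matrixP => a c; rewrite [LHS]mxE [LHS]mxE MUS !mxE.
rewrite -hz_shift /= /bump /= !add1n; congr (_ - _ * _); congr hz; lia.
Qed.

End CompleteSymmetric.

Lemma rmorph_hz (A B : comNzRingType) (h : {rmorphism A -> B}) (x : nat -> A) s z :
  h (hz x s z) = hz (h \o x) s z.
Proof.
elim: s z => [|s IH] z; first by rewrite !hz0 rmorph_nat.
elim/int_ind_ge0: z => z H; first by rewrite !hz_lt0 ?rmorph0.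
by rewrite hzS [RHS]hzS rmorphD rmorphM H IH.
Qed.

(** The flagged Jacobi-Trudi determinant for 1^m x w0k(kb + r), with flag m + a + 1 in row a; see
    [schubert_block]. *)
Definition block_det (A : comNzRingType) (x : nat -> A) (k b r m : nat) : A :=
  \det (\matrix_(a < k * b, c < k * b)
    hz x (m + a.+1) ((r + k * (b - (a %/ k).+1))%:Z - a%:Z + c%:Z)).

Fixpoint multi_layered_det (A : comNzRingType) (x : nat -> A) (k b r m : nat)
    (bs : seq nat) : A :=
  if bs is b' :: bs' then
    block_det x k b' 0 m * multi_layered_det x k b r (m + k * b') bs'
  else block_det x k b r m.

(** * Schubert polynomials of multi-layered permutations *)

Module SchubertTheory.
Import mpoly.
Import Defs.Schubert.

(** * Commutation and braid relations of divided differences *)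

Section DividedDifferences.
Variable n : nat.
Implicit Types (i j k l : 'I_n) (f g : {mpoly int[n]}).

Lemma mpolyX_inj i j : 'X_i = 'X_j :> {mpoly int[n]} -> i = j.
Proof.
move=> /(congr1 (fun p : {mpoly int[n]} => p@_U_(j)))/eqP.
by rewrite !mcoeffXU eqxx; case: (eqVneq i j).
Qed.

Lemma subXX_neq0 i j : i != j -> 'X_i - 'X_j != 0 :> {mpoly int[n]}.
Proof. by apply: contraNneq => /subr0_eq/mpolyX_inj ->. Qed.

Lemma msym_tpermK i j f : msym (tperm i j) (msym (tperm i j) f) = f.
Proof. by rewrite -msymMm tperm2 msym1m. Qed.

Lemma msymXU (s : 'S_n) i : msym s 'X_i = 'X_(s i) :> {mpoly int[n]}.
Proof.
rewrite msymX /=; congr mpolyX; apply/mnmP => r.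
by rewrite !mnmE -(inj_eq (@perm_inj _ s)) permKV.
Qed.

(** Cancelling ['X_i - 'X_j] in a domain turns questions on divided differences into identities for
    [msym]. The explicit sum is unfolded only to bound monomials, in [stair_divdiff]. *)
Lemma divdiff_eq i j f g : i != j ->
  ('X_i - 'X_j) * g = f - msym (tperm i j) f -> divdiff i j f = g.
Proof. by move=> ij; rewrite -divdiffP // => /(mulfI (subXX_neq0 ij)). Qed.

Lemma divdiff_sym i j f : i != j -> msym (tperm i j) f = f -> divdiff i j f = 0.
Proof. by move=> ij fs; apply: divdiff_eq; rewrite // mulr0 fs subrr. Qed.

Lemma divdiffMl i j f g : i != j -> msym (tperm i j) f = f ->
  divdiff i j (f * g) = f * divdiff i j g.
Proof.
move=> ij fs; apply: divdiff_eq => //.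
by rewrite msymM fs mulrCA divdiffP // mulrBr.
Qed.

Lemma msym_divdiff i j f :
  i != j -> msym (tperm i j) (divdiff i j f) = divdiff i j f.
Proof.
move=> ij; apply: (mulfI (subXX_neq0 ij)).
have := congr1 (msym (tperm i j)) (divdiffP f ij).
rewrite msymM !msymB !msymXU tpermL tpermR msym_tpermK => /eqP.
by rewrite -[X in X == _]opprK -mulNr opprB eqr_oppLR opprB => /eqP ->; rewrite divdiffP.
Qed.

Lemma divdiffB i j f g : i != j ->
  divdiff i j (f - g) = divdiff i j f - divdiff i j g.
Proof.
move=> ij; apply: divdiff_eq => //; rewrite mulrBr !divdiffP // msymB.
by rewrite !opprB !addrA; ring.
Qed.

Lemma tperm_comm i j k l : i != k -> i != l -> j != k -> j != l ->
  (tperm i j * tperm k l = tperm k l * tperm i j)%g.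
Proof. by move=> ik il jk jl; rewrite conjgC tpermJ !tpermD // eq_sym. Qed.

Lemma tperm_braid i j k : i != j -> j != k -> i != k ->
  (tperm i j * tperm j k * tperm i j = tperm j k * tperm i j * tperm j k)%g.
Proof.
move=> ij jk ik.
have E x y z t : (tperm x y * tperm z t * tperm x y = tperm z t ^ tperm x y :> 'S_n)%g.
  by rewrite conjgE tpermV mulgA.
by rewrite !E !tpermJ tpermL tpermR !tpermD // eq_sym.
Qed.

Lemma divdiffC i j k l f : i != j -> k != l ->
    i != k -> i != l -> j != k -> j != l ->
  divdiff i j (divdiff k l f) = divdiff k l (divdiff i j f).
Proof.
move=> ij kl ik il jk jl.
have sym1 : msym (tperm k l) ('X_i - 'X_j) = 'X_i - 'X_j :> {mpoly int[n]}.
  by rewrite msymB !msymXU !tpermD // eq_sym.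
have sym2 : msym (tperm i j) ('X_k - 'X_l) = 'X_k - 'X_l :> {mpoly int[n]}.
  by rewrite msymB !msymXU !tpermD.
apply: divdiff_eq => //; rewrite -divdiffMl // divdiffP // divdiffB //.
congr (_ - _); apply: divdiff_eq => //.
rewrite -[X in X * _]sym2 -msymM divdiffP // msymB -!msymMm.
by rewrite (tperm_comm ik).
Qed.

(** Multiplied by the Vandermonde product of the three variables, both sides become the alternating
    sum of [f] over the six permutations of these variables. *)
Lemma divdiff_braid i j k f : i != j -> j != k -> i != k ->
  divdiff i j (divdiff j k (divdiff i j f)) =
  divdiff j k (divdiff i j (divdiff j k f)).
Proof.
move=> ij jk ik; pose s := @msym n int (tperm i j); pose t := @msym n int (tperm j k).
pose a : {mpoly int[n]} := 'X_i; pose b : {mpoly int[n]} := 'X_j.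
pose c : {mpoly int[n]} := 'X_k.
have [sa sb sc] : [/\ s a = b, s b = a & s c = c].
  by rewrite /s !msymXU tpermL tpermR tpermD // eq_sym.
have [ta tb tc] : [/\ t a = a, t b = c & t c = b].
  by rewrite /t !msymXU tpermL tpermR tpermD // eq_sym.
have sts : s (t (s f)) = t (s (t f)) by rewrite /s /t -!msymMm !mulgA tperm_braid.
have sD g : (a - b) * divdiff i j g = g - s g by apply: divdiffP.
have tD g : (b - c) * divdiff j k g = g - t g by apply: divdiffP.
have sds g : s (divdiff i j g) = divdiff i j g by apply: msym_divdiff.
have tdt g : t (divdiff j k g) = divdiff j k g by apply: msym_divdiff.
have sM g h : s (g * h) = s g * s h by apply: msymM.
have tM g h : t (g * h) = t g * t h by apply: msymM.
have sB g h : s (g - h) = s g - s h by apply: msymB.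
have tB g h : t (g - h) = t g - t h by apply: msymB.
have V0 : (a - b) * ((b - c) * (a - c)) != 0.
  by rewrite !mulf_neq0 // subXX_neq0.
apply: (mulfI V0); clearbody a b c s t.
transitivity (f - s f - t f + t (s f) + s (t f) - s (t (s f))).
  set g := divdiff i j f; set h := divdiff j k g.
  have e1 : (a - c) * s h = g - s (t g).
    by have := congr1 s (tD g); rewrite sM !sB sb sc sds.
  have e2 : (a - c) * t g = t f - t (s f).
    by have := congr1 t (sD f); rewrite tM !tB ta tb.
  have e3 : (b - c) * s (t g) = s (t f) - s (t (s f)).
    by have := congr1 s e2; rewrite sM !sB sa sc.
  have -> : (a - b) * ((b - c) * (a - c)) * divdiff i j h =
      (a - c) * ((b - c) * h) - (b - c) * ((a - c) * s h).
    by rewrite mulrAC sD; ring.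
  rewrite e1 tD.
  have -> : (a - c) * (g - t g) - (b - c) * (g - s (t g)) =
     (a - b) * g - (a - c) * t g + (b - c) * s (t g) by ring.
  by rewrite sD e2 e3 ; ring.
set g := divdiff j k f; set h := divdiff i j g.
have e1 : (a - c) * t h = g - t (s g).
  by have := congr1 t (sD g); rewrite tM !tB ta tb tdt.
have e2 : (a - c) * s g = s f - s (t f).
  by have := congr1 s (tD f); rewrite sM !sB sb sc.
have e3 : (a - b) * t (s g) = t (s f) - t (s (t f)).
  by have := congr1 t e2; rewrite tM !tB ta tc.
have -> : (a - b) * ((b - c) * (a - c)) * divdiff j k h =
    (a - c) * ((a - b) * h) - (a - b) * ((a - c) * t h).
  transitivity ((a - b) * (a - c) * ((b - c) * divdiff j k h)); first by ring.
  by rewrite tD; ring.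
rewrite e1 sD.
have -> : (a - c) * (g - s g) - (a - b) * (g - t (s g)) =
   (b - c) * g - (a - c) * s g + (a - b) * t (s g) by ring.
by rewrite tD e2 e3 sts; ring.
Qed.
End DividedDifferences.

(** * Independence of the chain of ascents *)

Section Ascents.
Variable n : nat.
Implicit Types (i j k l : 'I_n) (w u : 'S_n) (f g : {mpoly int[n]}).

(** All noninversions, adjacent or not. Their number is the induction measure, and 'C(n, 2) minus it
    is the degree of S_w. *)
Definition ascents w : {set 'I_n * 'I_n} :=
  [set p : 'I_n * 'I_n | (p.1 < p.2)%N && (w p.1 < w p.2)%N].

Lemma ltn_tperm i j k l : j = i.+1 :> nat -> (k < l)%N -> (k, l) != (i, j) ->
  (tperm i j k < tperm i j l)%N.
Proof.
rewrite xpair_eqE -!val_eqE /= => ij.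
by case: tpermP => [->|->|/eqP + /eqP +]; case: tpermP => [->|->|/eqP + /eqP +];
   rewrite -?val_eqE /=; lia.
Qed.

Lemma neq_adj i j : j = i.+1 :> nat -> i != j.
Proof. by rewrite -val_eqE /= => ->; rewrite neq_ltn ltnSn. Qed.

Lemma card_ascents_tperm i j w : j = i.+1 :> nat -> (w i < w j)%N ->
  #|ascents w| = #|ascents (tperm i j * w)|.+1.
Proof.
move=> ij wij; set s := tperm i j.
pose h (p : 'I_n * 'I_n) := (s p.1, s p.2).
have hK : involutive h by case=> a b; rewrite /h /= !tpermK.
have -> : ascents w = (i, j) |: h @: ascents (s * w)%g.
  apply/setP => -[a b]; rewrite !inE /=.
  have [[-> ->]|nab] := eqVneq (a, b) (i, j); first by rewrite ij ltnSn wij.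
  apply/idP/imsetP => [/andP[ab wab]|[[c d]]].
    exists (h (a, b)); last by rewrite hK.
    by rewrite inE /= !permM !tpermK wab ltn_tperm.
  rewrite inE /= !permM => /andP[cd wcd] [-> ->]; rewrite wcd ltn_tperm //.
  apply/eqP => -[ci dj]; move: wcd; rewrite ci dj /s tpermL tpermR.
  by rewrite ltnNge (ltnW wij).
rewrite cardsU1 card_imset; last exact: inv_inj.
case: imsetP => // -[[c d]]; rewrite inE /= => /andP[cd _] [/esym ci /esym dj].
have {}ci : c = j by rewrite -[c](tpermK i j) -/s ci tpermL.
have {}dj : d = i by rewrite -[d](tpermK i j) -/s dj tpermR.
by move: cd; rewrite ci dj ij ltnNge leqnSn.
Qed.

Lemma card_ord_lt (m : nat) : (m <= n)%N -> #|[set i : 'I_n | (i < m)%N]| = m.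
Proof.
move=> mn; have inj : injective (widen_ord mn).
  by move=> x y /(congr1 val) /= /val_inj.
rewrite -[RHS]card_ord -(card_imset _ inj).
congr #|pred_of_set _|; apply/setP => i; rewrite inE; apply/idP/imsetP => [im|[x _ ->]].
  by exists (Ordinal im) => //; apply: val_inj.
exact: (ltn_ord x).
Qed.

Lemma card_ltn_pairs :
  #|[set p : 'I_n * 'I_n | (p.1 < p.2)%N]| = 'C(n, 2).
Proof.
rewrite -bin2_sum big_mkord -sum1_card.
rewrite (eq_bigl (fun p : 'I_n * 'I_n => (p.1 < p.2)%N)); last by move=> p; rewrite inE.
rewrite big_mkcond /= -(pair_big xpredT xpredT (fun i j : 'I_n => if (i < j)%N then 1%N
  else 0%N)) /=.
rewrite exchange_big /=; apply: eq_bigr => j _.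
by rewrite -big_mkcond sum1_card -[RHS](@card_ord_lt j (ltnW (ltn_ord j))) cardsE.
Qed.

Lemma card_ascents_le w : (#|ascents w| <= 'C(n, 2))%N.
Proof.
rewrite -card_ltn_pairs; apply: subset_leq_card; apply/subsetP => p.
by rewrite !inE => /andP[].
Qed.

Lemma card_ascents_max w : #|ascents w| = 'C(n, 2) -> w = 1%g.
Proof.
move=> wn; have /eqP E : ascents w == [set p : 'I_n * 'I_n | (p.1 < p.2)%N].
  rewrite eqEcard card_ltn_pairs wn leqnn andbT.
  by apply/subsetP => p; rewrite !inE => /andP[].
have mono i j : (i < j)%N -> (w i < w j)%N.
  move=> ij; have : (i, j) \in ascents w by rewrite E inE.
  by rewrite inE /= ij.
have monoE i j : (w i < w j)%N = (i < j)%N.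
  apply/idP/idP; last exact: mono.
  by apply: contraTT; rewrite -!leqNgt leq_eqVlt => /orP[/eqP/val_inj -> //|/mono/ltnW].
apply/permP => i; rewrite perm1; apply: val_inj => /=.
rewrite -[LHS](@card_ord_lt (w i) (ltnW (ltn_ord _))) -[RHS](@card_ord_lt i (ltnW
  (ltn_ord _))).
rewrite -(card_imset [set a : 'I_n | (a < i)%N] (@perm_inj _ w)); congr #|pred_of_set _|.
apply/setP => a; rewrite inE; apply/idP/imsetP => [ai|[b + ->]];
  last by rewrite inE monoE.
by exists (w^-1%g a); rewrite ?permKV // inE -monoE permKV.
Qed.

(* Matsumoto's argument: the rewriting w -> s_i w at ascents is locally
   confluent, because divided differences commute at distance at least 2 and
   satisfy the braid relation otherwise. *)
Lemma schubert_rec_ascent (N N' : nat) i j w :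
  j = i.+1 :> nat -> (w i < w j)%N ->
  (#|ascents w| <= N)%N -> (#|ascents (tperm i j * w)| <= N')%N ->
  schubert_rec N w = divdiff i j (schubert_rec N' (tperm i j * w)).
Proof.
have [e] := ubnP #|ascents w|; elim: e => // e IH in N N' i j w *.
rewrite ltnS => we ij wij.
(* The number of steps allowed does not matter once it reaches the number of noninversions: both
   recursions are compared along one and the same ascent. *)
have indep u M M' : (#|ascents u| < e)%N -> (#|ascents u| <= M)%N ->
    (#|ascents u| <= M')%N -> schubert_rec M u = schubert_rec M' u.
  move=> ue uM uM'.
  have [[a b] /= /andP[/eqP ab uab]|no] :=
    pickP (fun p : 'I_n * 'I_n => (p.2 == p.1.+1 :> nat) && (u p.1 < u p.2)%N).
    have c := card_ascents_tperm ab uab.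
    have cM' : (#|ascents (tperm a b * u)%g| <= M')%N by lia.
    exact: etrans (IH M M' a b u ue ab uab uM cM') (esym (IH M' M' a b u ue ab uab uM'
      cM')).
  have E L : schubert_rec L u = \prod_(i < n) 'X_i ^+ (n - i.+1).
    by case: L => //= L; rewrite (eq_pick no); case: pickP.
  by rewrite !E.
(* Overlapping ascents: three steps along either side of the braid hexagon end at the same
   permutation. *)
have braid (x y z : 'I_n) M M' : y = x.+1 :> nat -> z = y.+1 :> nat ->
    (w x < w y)%N -> (w y < w z)%N ->
    (#|ascents (tperm x y * w)%g| <= M)%N -> (#|ascents (tperm y z * w)%g| <= M')%N ->
    divdiff y z (schubert_rec M' (tperm y z * w)) =
    divdiff x y (schubert_rec M (tperm x y * w)).
  move=> xy yz wxy wyz uM uM'.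
  have xyN := neq_adj xy; have yzN := neq_adj yz.
  have xzN : x != z by rewrite -val_eqE /= yz xy; lia.
  have c := card_ascents_tperm xy wxy; have c' := card_ascents_tperm yz wyz.
  set u := (tperm x y * w)%g in uM c *; set u' := (tperm y z * w)%g in uM' c' *.
  have [ux uy uz] : [/\ u x = w y, u y = w x & u z = w z].
    by rewrite !permM tpermL tpermR tpermD.
  have [u'x u'y u'z] : [/\ u' x = w x, u' y = w z & u' z = w y].
    by rewrite !permM tpermL tpermR tpermD // eq_sym.
  have wxz := ltn_trans wxy wyz.
  have uyz : (u y < u z)%N by rewrite uy uz.
  have u'xy : (u' x < u' y)%N by rewrite u'x u'y.
  have d := card_ascents_tperm yz uyz; have d' := card_ascents_tperm xy u'xy.
  set v := (tperm y z * u)%g in d; set v' := (tperm x y * u')%g in d'.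
  have [vx vy] : v x = w y /\ v y = w z.
    by rewrite !(permM (tperm y z)) tpermL tpermD // eq_sym.
  have [v'y v'z] : v' y = w x /\ v' z = w y.
    by rewrite !(permM (tperm x y)) tpermR tpermD.
  have vxy : (v x < v y)%N by rewrite vx vy.
  have v'yz : (v' y < v' z)%N by rewrite v'y v'z.
  have f := card_ascents_tperm xy vxy; have f' := card_ascents_tperm yz v'yz.
  rewrite (IH M e y z u) -/v //; try lia.
  rewrite (IH M' e x y u') -/v' //; try lia.
  rewrite (IH e e x y v) //; try lia.
  rewrite (IH e e y z v') //; try lia.
  rewrite divdiff_braid //;
    congr (divdiff _ _ (divdiff _ _ (divdiff _ _ (schubert_rec _ _)))).
  by rewrite /v /v' /u /u' !mulgA tperm_braid.
case: N => [|N] wN; first by have := card_ascents_tperm ij wij; lia.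
move=> wN'; rewrite [LHS]/=; case: pickP => [[a b] /= /andP[/eqP ab wab]|no]; last first.
  by have := no (i, j); rewrite /= ij eqxx wij.
have := card_ascents_tperm ab wab; have := card_ascents_tperm ij wij.
set u := (tperm i j * w)%g; set u' := (tperm a b * w)%g => cu cu'.
have [ai|ai] := eqVneq a i.
  have bj : b = j by apply: val_inj; rewrite /= ab ai ij.
  by rewrite /u' /u ai bj in cu cu' *; congr divdiff; apply: indep; lia.
have ibN : i != j := neq_adj ij.
have abN : a != b := neq_adj ab.
have bj : b != j by rewrite -val_eqE /= ab ij eqSS val_eqE.
have [aj|aj] := eqVneq a j; last have [bi|bi] := eqVneq b i.
- rewrite aj in ab wab cu' wN' *; rewrite /u' aj; apply: (braid i j b N' N) => //;
  last first.
    by rewrite -ltnS; apply: leq_trans wN; rewrite cu' /u' aj.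
- rewrite bi in ab wab *.
  rewrite /u' bi; apply/esym; apply: (braid a i j N N') => //.
  by rewrite -ltnS; apply: leq_trans wN; rewrite cu' /u' bi.
have ua : u a = w a by rewrite permM tpermD // eq_sym.
have ub : u b = w b by rewrite permM tpermD // eq_sym.
have u'i : u' i = w i by rewrite permM tpermD.
have u'j : u' j = w j by rewrite permM tpermD.
have cab : (#|ascents (tperm a b * u)|.+1 = #|ascents u|)%N.
  by rewrite -card_ascents_tperm // ua ub.
have cij : (#|ascents (tperm i j * u')|.+1 = #|ascents u'|)%N.
  by rewrite -card_ascents_tperm // u'i u'j.
rewrite (IH N e i j u') ?u'i ?u'j //; try lia.
rewrite (IH N' e a b u) ?ua ?ub //; try lia.
by rewrite divdiffC // 1?eq_sym // /u /u' !mulgA tperm_comm // eq_sym.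
Qed.
End Ascents.

(** * Schubert polynomials of dominant permutations *)

Section Dominant.
Variable n : nat.
Implicit Types (i j k l : 'I_n) (w u v : 'S_n) (f g : {mpoly int[n]}).

Lemma schubert_ascent i j w : j = i.+1 :> nat -> (w i < w j)%N ->
  schubert w = divdiff i j (schubert (tperm i j * w)).
Proof. by move=> ij wij; apply: schubert_rec_ascent => //; apply: card_ascents_le. Qed.

Lemma schubert_descent i j w : j = i.+1 :> nat -> (w j < w i)%N ->
  divdiff i j (schubert w) = schubert (tperm i j * w).
Proof.
move=> ij wij; rewrite [RHS](schubert_ascent ij) ?permM ?tpermL ?tpermR //.
by rewrite mulgA tperm2 mul1g.
Qed.

Lemma schubert_sym i j w : j = i.+1 :> nat -> (w i < w j)%N ->
  msym (tperm i j) (schubert w) = schubert w.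
Proof. by move=> ij wij; rewrite (schubert_ascent ij wij) msym_divdiff // neq_adj. Qed.

Lemma schubert_w0 w : (forall i j, j = i.+1 :> nat -> (w j < w i)%N) ->
  schubert w = \prod_(i < n) 'X_i ^+ (n - i.+1).
Proof.
rewrite /schubert => dec; case: 'C(n, 2) => //= N.
by case: pickP => // -[i j] /= /andP[/eqP ij wij]; have := dec i j ij; lia.
Qed.

Lemma perm_adj_decr w : (forall i j, j = i.+1 :> nat -> (w j < w i)%N) ->
  forall i j, (i < j)%N -> (w j < w i)%N.
Proof.
move=> dec i [j jn] /=; elim: j jn => // j IH jn.
have jn' := ltnW jn; rewrite ltnS leq_eqVlt => /orP[/eqP ij|ij].
  by apply: dec; rewrite /= ij.
by apply: ltn_trans (IH jn' ij); apply: dec.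
Qed.

(** The leftmost ascent is singled out because [dominant_schubert] needs a descent just before it in
    order to stay dominant. *)
Lemma adj_ascent_or_decr w :
  (exists i j, [/\ j = i.+1 :> nat, (w i < w j)%N &
     forall k l, l = k.+1 :> nat -> (l <= i)%N -> (w l < w k)%N])
  \/ (forall i j, j = i.+1 :> nat -> (w j < w i)%N).
Proof.
pose P t := [exists p : 'I_n * 'I_n, [&& p.1 == t :> nat, p.2 == p.1.+1 :> nat
  & (w p.1 < w p.2)%N]].
have flip k l : l = k.+1 :> nat -> ~~ P k -> (w l < w k)%N.
  move=> kl /existsPn/(_ (k, l)); rewrite /= kl !eqxx /= -leqNgt leq_eqVlt.
  by case/orP => // /eqP/val_inj/perm_inj lk; move: kl; rewrite lk; lia.
have [exP|noP] := boolP [exists t : 'I_n, P t].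
  have {}exP : exists t, P t by have /existsP[t] := exP; exists t.
  case: (ex_minnP exP) => t /existsP[[i j] /= /and3P[/eqP it /eqP ij wij]] tmin.
  left; exists i, j; split=> // k l kl li; apply: flip => //.
  by apply/negP => /tmin; rewrite -it; lia.
right=> i j ij; apply: flip => //.
by apply: contraNN noP => Pi; apply/existsP; exists i.
Qed.

Definition code w i := #|[set j : 'I_n | (i < j)%N && (w j < w i)%N]|.

(** Removing an adjacent ascent exchanges two entries of the Lehmer code and adds 1 to the first; as
    the entries are equal here, only the addition is visible. *)
Lemma code_tperm i j w k : j = i.+1 :> nat -> (w i < w j)%N ->
  code w i = code w j -> code (tperm i j * w) k = (code w k + (k == i))%N.
Proof.
move=> ij wij cij; rewrite /code.
have [->|ki] := eqVneq k i.
  rewrite addn1 -/(code w i) cij /code.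
  have -> : [set l : 'I_n | (i < l)%N && ((tperm i j * w)%g l < (tperm i j * w)%g i)%N]
     = j |: [set l : 'I_n | (j < l)%N && (w l < w j)%N].
    apply/setP => l; rewrite !inE !permM tpermL.
    have [->|lj] := eqVneq l j; first by rewrite tpermR ij ltnSn wij.
    have [->|li] := eqVneq l i; first by rewrite ltnn ij; lia.
    rewrite tpermD 1?eq_sym //; congr andb; rewrite ij.
    by move: lj; rewrite -val_eqE /= ij; lia.
  by rewrite cardsU1 inE ltnn.
rewrite addn0; have [->|kj] := eqVneq k j.
  rewrite -/(code w j) -cij; apply/eq_card => l; rewrite !inE !permM tpermR.
  have [->|lj] := eqVneq l j; first by rewrite ltnn ij ltnSn tpermR /= ltnNge (ltnW wij).
  have [->|li] := eqVneq l i; first by rewrite ltnn ij; lia.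
  rewrite tpermD 1?eq_sym //; congr andb; rewrite ij.
  by move: lj; rewrite -val_eqE /= ij; lia.
rewrite -(card_imset [set l : 'I_n |
  (k < l)%N && (w l < w k)%N] (@perm_inj _ (tperm i j))).
apply/eq_card => l; rewrite -[l in RHS](tpermK i j) mem_imset; last exact: perm_inj.
rewrite !inE !permM (tpermD (z := k)) 1?eq_sym //; congr andb.
move: ki kj; rewrite -!val_eqE /=.
by case: tpermP => [->|->|_ _]; rewrite ?ij; lia.
Qed.

(** At the leftmost ascent, dominance forces equal code entries. The monomial of s_i w is then
    ['X_i] times a monomial symmetric in ['X_i] and ['X_j], and the divided difference of ['X_i] is
    1. *)
Lemma dominant_schubert w : (forall i j, (i <= j)%N -> (code w j <= code w i)%N) ->
  schubert w = \prod_(i < n) 'X_i ^+ code w i.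
Proof.
have [e] := ubnP #|ascents w|; elim: e => // e IH in w *; rewrite ltnS => we dom.
have [[i [j [ij wij first]]]|dec] := adj_ascent_or_decr w; last first.
  rewrite schubert_w0 //; apply: eq_bigr => i _; congr (_ ^+ _).
  have -> : code w i = #|~: [set j : 'I_n | (j < i.+1)%N]|.
    apply: eq_card => j; rewrite !inE -leqNgt; case: ltnP => //= ij.
    exact: perm_adj_decr.
  by rewrite cardsCs setCK card_ord card_ord_lt // ltn_ord.
have cij : code w i = code w j.
  apply/eqP; rewrite eqn_leq (dom i j) ?ij ?leqnSn // andbT.
  apply: subset_leq_card; apply/subsetP => l; rewrite !inE => /andP[il wl].
  rewrite (ltn_trans wl wij) andbT ltn_neqAle ij il andbT.
  by apply: contraTneq wl => /esym; rewrite -ij => /val_inj ->; rewrite -leqNgt ltnW.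
rewrite (schubert_ascent ij wij) IH; last 2 first.
- by have := card_ascents_tperm ij wij; lia.
- move=> p q pq; rewrite !code_tperm //.
  have [qi|] := eqVneq q i; last by have := dom p q pq; lia.
  have [->|pi] := eqVneq p i; first by rewrite qi.
  rewrite qi addn1 addn0.
  have i0 : (i.-1 < n)%N by apply: leq_ltn_trans (ltn_ord i); exact: leq_pred.
  have pi' : (p < i)%N by move: pi pq; rewrite qi -val_eqE /=; lia.
  apply: (@leq_trans (code w (Ordinal i0))); last by apply: dom => /=; lia.
  (* Every position counted at i is counted at i - 1 as well, and so is i itself: the code drops
     strictly from i - 1 to i, which leaves room for the added 1. *)
  have wi : (w i < w (Ordinal i0))%N by apply: first => //=; lia.
  apply: proper_card; rewrite properE; apply/andP; split.
    apply/subsetP => l; rewrite !inE /= => /andP[il wl]; rewrite (ltn_trans wl wi) andbT.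
    by lia.
  apply/subsetPn; exists i; rewrite !inE ?ltnn //= wi andbT; lia.
have -> : \prod_(k < n) 'X_k ^+ code (tperm i j * w) k =
   (\prod_(k < n) 'X_k ^+ code w k) * 'X_i :> {mpoly int[n]}.
  rewrite (bigD1 i) //= [in RHS](bigD1 i) //= code_tperm // eqxx addn1 exprS.
  rewrite -!mulrA mulrC -!mulrA; congr (_ * _); congr (_ * _).
  by apply: eq_bigr => k /negPf ki; rewrite code_tperm // ki addn0.
have ijN := neq_adj ij.
rewrite divdiffMl //; last first.
  rewrite rmorph_prod /= (reindex_inj (@perm_inj _ (tperm i j))) /=.
  apply: eq_bigr => k _; rewrite rmorphXn /= msymXU tpermK; congr (_ ^+ _).
  by case: tpermP => [->|->|].
suff -> : divdiff i j 'X_i = 1 :> {mpoly int[n]} by rewrite mulr1.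
by apply: divdiff_eq => //; rewrite mulr1 msymXU tpermL.
Qed.

Lemma schubert1 : schubert (1 : 'S_n) = 1.
Proof.
have c0 i : code 1 i = 0%N.
  apply/eqP; rewrite cards_eq0; apply/eqP/setP => j; rewrite !inE !perm1.
  by case: ltngtP.
rewrite dominant_schubert => [|i j _]; last by rewrite !c0.
by rewrite big1 // => i _; rewrite c0.
Qed.
End Dominant.

(** * Staircase bound on the support, and factorization over direct products *)

Section Support.
Variable n : nat.
Implicit Types (i j k l : 'I_n) (w u v : 'S_n) (f g : {mpoly int[n]}).

(** The two inputs of the uniqueness argument: the exponent bound excludes the last variable, and
    homogeneity excludes a constant term when d > 0. *)
Definition stair (d : nat) f := forall m, m \in msupp f ->
  (forall i, m i <= n - i.+1)%N /\ mdeg m = d.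

Lemma stair0 d : stair d 0. Proof. by move=> m; rewrite msupp0. Qed.

Lemma stairD d f g : stair d f -> stair d g -> stair d (f + g).
Proof.
by move=> df dg m /msuppD_le; rewrite mem_cat => /orP[/df|/dg].
Qed.

Lemma stairN d f : stair d f -> stair d (- f).
Proof. by move=> df m; rewrite (perm_mem (msuppN f)) => /df. Qed.

Lemma stairZ d c f : stair d f -> stair d (c *: f).
Proof. by move=> df m /msuppZ_le /df. Qed.

Lemma stair_sum (I : eqType) (r : seq I) (F : I -> {mpoly int[n]}) d :
  (forall x, x \in r -> stair d (F x)) -> stair d (\sum_(x <- r) F x).
Proof.
move=> rF; rewrite big_seq; elim/big_ind: _ => //; [exact: stair0|exact: stairD].
Qed.

(** Both new exponents are smaller than the larger of the old ones, hence at most n - j - 1, the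
    stricter of the two bounds. *)
Lemma stair_divdiff d i j f :
  j = i.+1 :> nat -> stair d.+1 f -> stair d (divdiff i j f).
Proof.
move=> ij df; have ijN := neq_adj ij; apply: stair_sum => m mf; apply: stairZ.
have [mb md] := df m mf; have mi := mb i; have mj := mb j.
have term (c e : nat) : (c <= n - j.+1 -> e <= n - j.+1 -> c + e + 1 = m i + m j ->
    stair d ((\prod_(l < n | (l != i) && (l != j)) 'X_l ^+ m l) *
             ('X_i ^+ c * 'X_j ^+ e)))%N.
  move=> cj ej ce.
  pose m' : 'X_{1..n} := [multinom (if l == i then c else if l == j then e else m l) |
    l < n].
  have -> : (\prod_(l < n | (l != i) && (l != j)) 'X_l ^+ m l) *
             ('X_i ^+ c * 'X_j ^+ e) = 'X_[m'] :> {mpoly int[n]}.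
    rewrite [RHS]mpolyXE_id [RHS](bigD1 i) //= [X in _ = _ * X](bigD1 j) 1?eq_sym //=.
    rewrite mulrC !mnmE !eqxx eq_sym (negPf ijN) mulrA; congr (_ * _).
    by apply: eq_bigr => l /andP[/negPf li /negPf lj]; rewrite mnmE li lj.
  move=> m''; rewrite msuppX inE => /eqP ->; split=> [l|].
    rewrite mnmE; case: eqP => [->|_]; first by lia.
    by case: eqP => [->|_].
  have degE (p : 'X_{1..n}) : mdeg p =
      (p i + (p j + \sum_(l < n | (l != i) && (l != j)) p l))%N.
    by rewrite mdegE (bigD1 i) //= (bigD1 j) 1?eq_sym.
  rewrite degE !mnmE !eqxx eq_sym (negPf ijN).
  rewrite (eq_bigr m) => [|l /andP[/negPf li /negPf lj]]; last by rewrite mnmE li lj.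
  move: md ce; rewrite degE => + ce; rewrite !addnA -ce;
    move: (\sum_(l < n | _) _)%N => S; lia.
rewrite mulrBr !mulr_sumr; apply: stairD; last apply: stairN;
  by apply: stair_sum => c; rewrite mem_index_iota => /andP[c1 c2]; apply: term; lia.
Qed.

Lemma stair_schubert w : stair ('C(n, 2) - #|ascents w|) (schubert w).
Proof.
have [e] := ubnP #|ascents w|; elim: e => // e IH in w *; rewrite ltnS => we.
have [[i [j [ij wij _]]]|dec] := adj_ascent_or_decr w.
  rewrite (schubert_ascent ij wij); apply: stair_divdiff => //.
  have c := card_ascents_tperm ij wij; have le := card_ascents_le w.
  have -> : ('C(n, 2) - #|ascents w|).+1 = ('C(n, 2) - #|ascents (tperm i j * w)%g|)%N.
    by lia.
  by apply: IH; lia.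
rewrite schubert_w0 //.
pose m : 'X_{1..n} := [multinom (n - i.+1)%N | i < n].
have -> : \prod_(i < n) 'X_i ^+ (n - i.+1) = 'X_[m] :> {mpoly int[n]}.
  by rewrite [RHS]mpolyXE_id; apply: eq_bigr => i _; rewrite mnmE.
move=> m'; rewrite msuppX inE => /eqP ->; split=> [i|]; first by rewrite mnmE.
have -> : ascents w = set0.
  apply/setP => -[i j]; rewrite !inE /=; case: ltnP => //= /(perm_adj_decr dec).
  by case: ltngtP.
rewrite cards0 subn0 mdegE -bin2_sum big_mkord (reindex_inj rev_ord_inj) /=.
by apply: eq_bigr => i _; rewrite mnmE /=; have := ltn_ord i; lia.
Qed.

(** Symmetry transports the absence of the last variable to all the others. *)
Lemma sym_mpolyC f :
  (forall i j, j = i.+1 :> nat -> msym (tperm i j) f = f) ->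
  (forall m i, m \in msupp f -> i.+1 = n -> m i = 0%N) ->
  f = (f@_0%MM)%:MP.
Proof.
move=> fs fn; have H d : forall i, (i + d.+1)%N = n -> forall m, m \in msupp f -> m i =
  0%N.
  elim: d => [|d IH] i id m mf; first by apply: fn => //; lia.
  have jn : (i.+1 < n)%N by lia.
  set j := Ordinal jn; have ij : j = i.+1 :> nat by [].
  have /(IH j) : [multinom m (tperm i j k) | k < n]%MM \in msupp f.
    by rewrite mcoeff_msupp -mcoeff_sym fs // -mcoeff_msupp.
  by rewrite mnmE tpermR; apply => /=; lia.
apply/mpolyP => m; rewrite mcoeffC.
have [->|m0] := eqVneq m 0%MM; first by rewrite mulr1.
rewrite mulr0; apply/eqP; rewrite mcoeff_eq0; apply: contraNN m0 => mf.
apply/eqP/mnmP => i; rewrite mnm0E; apply: (H (n - i.+1)%N) => //.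
by have := ltn_ord i; lia.
Qed.

Lemma schubert_coef0 w : w != 1%g -> (schubert w)@_0%MM = 0.
Proof.
move=> w1; apply/eqP; rewrite mcoeff_eq0; apply/negP => /stair_schubert[_].
rewrite mdeg0 => /esym/eqP; rewrite subn_eq0 => le; case/eqP: w1.
by apply: card_ascents_max; apply/eqP; rewrite eqn_leq card_ascents_le.
Qed.

Lemma schubert_last w m i : m \in msupp (schubert w) -> i.+1 = n -> m i = 0%N.
Proof. by move=> /stair_schubert[/(_ i) mi _] ni; lia. Qed.

(* The difference of the two sides is killed by every divided difference, hence
   symmetric; as it does not involve the last variable, it is constant. *)
Lemma schubertM (m : nat) u v :
  (forall i, (m <= i)%N -> u i = i) -> (forall i, (i < m)%N -> v i = i) ->
  schubert (u * v) = schubert u * schubert v.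
Proof.
have [e] := ubnP ('C(n, 2) - #|ascents u| + ('C(n, 2) - #|ascents v|)).
elim: e => // e IH in u v *; rewrite ltnS => uve um vm.
have ult i : (i < m)%N -> (u i < m)%N.
  move=> im; rewrite ltnNge; apply/negP => mu.
  by have /perm_inj ui := um _ mu; move: im; rewrite -ui ltnNge mu.
have vge i : (m <= i)%N -> (m <= v i)%N.
  move=> mi; rewrite leqNgt; apply/negP => mv.
  by have /perm_inj ui := vm _ mv; move: mi; rewrite -ui leqNgt mv.
have uvl i : (i < m)%N -> (u * v)%g i = u i by move=> im; rewrite permM vm // ult.
have uvr i : (m <= i)%N -> (u * v)%g i = v i by move=> im; rewrite permM um.
have [/eqP|uv1] := boolP ((u == 1%g) && (v == 1%g)).
  by move=> /eqP/andP[/eqP -> /eqP ->]; rewrite mulg1 schubert1 mulr1.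
have uv0 : (schubert u)@_0%MM * (schubert v)@_0%MM = 0.
  case: (altP (u =P 1%g)) uv1 => [_ /= v1|u1 _]; last by rewrite schubert_coef0 // mul0r.
  by rewrite [X in _ * X]schubert_coef0 // mulr0.
have uvN1 : (u * v)%g != 1%g.
  apply: contraNN uv1 => /eqP uv; apply/andP; split; apply/eqP/permP => i; rewrite perm1.
    by case: (ltnP i m) => im; [rewrite -uvl // uv perm1|apply: um].
  by case: (ltnP i m) => im; [apply: vm|rewrite -uvr // uv perm1].
apply/eqP; rewrite -subr_eq0; apply/eqP; rewrite [LHS]sym_mpolyC; first last.
- move=> p i /msuppB_le; rewrite mem_cat => /orP[/schubert_last H /H //|].
  move=> /msuppM_le/allpairsP[[a b] /= [ua vb ->]] ni.
  by rewrite mnmDE (schubert_last ua ni) (schubert_last vb ni).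
- move=> i j ij; have ijN := neq_adj ij.
  suff dd : divdiff i j (schubert (u * v)) = divdiff i j (schubert u * schubert v).
    have := divdiffP (schubert (u * v) - schubert u * schubert v) ijN.
    by rewrite divdiffB // dd subrr mulr0 => /esym/subr0_eq.
  have symM w : (w i < w j)%N -> divdiff i j (schubert w) = 0.
    by move=> wij; apply: divdiff_sym => //; apply: schubert_sym.
  have [jm|mj] := ltnP j m; last have [im|mi] := ltnP i m.
  + have im : (i < m)%N by lia.
    have vs : msym (tperm i j) (schubert v) = schubert v.
      by apply: schubert_sym; rewrite ?vm //; lia.
    rewrite mulrC divdiffMl // mulrC.
    have [uij|] := ltnP (u i) (u j); first by rewrite !symM ?mul0r // !uvl.
    rewrite leq_eqVlt => /orP[/eqP/val_inj/perm_inj ji|uij];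
      first by rewrite ji eqxx in ijN.
    rewrite !schubert_descent // ?uvl // mulgA IH //.
      have := @card_ascents_tperm _ i j (tperm i j * u)%g ij.
      rewrite mulgA tperm2 mul1g !permM tpermL tpermR => /(_ uij) c.
      have := card_ascents_le (tperm i j * u)%g; move: uve; rewrite c.
      by move: #|ascents u| #|ascents v| 'C(n, 2) => x y z; lia.
    move=> k mk; rewrite permM tpermD ?um //; rewrite -val_eqE /=; lia.
  (* At the boundary i = m - 1, j = m, all of [u], [v] and [u * v] have an ascent, so both divided
     differences vanish. *)
  + have uvs : ((u * v)%g i < (u * v)%g j)%N.
      by rewrite uvl // uvr //; apply: leq_trans (vge _ mj); apply: ult.
    rewrite symM // divdiff_sym // msymM !schubert_sym //.
      by rewrite vm //; apply: leq_trans (vge _ mj).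
    by rewrite (um j) //; apply: leq_trans mj; apply: ult.
  + have us : msym (tperm i j) (schubert u) = schubert u.
      by apply: schubert_sym; rewrite ?um //; lia.
    rewrite divdiffMl //.
    have [vij|] := ltnP (v i) (v j); first by rewrite !symM ?mulr0 // !uvr.
    rewrite leq_eqVlt => /orP[/eqP/val_inj/perm_inj ji|vij];
      first by rewrite ji eqxx in ijN.
    rewrite !schubert_descent // ?uvr //.
    have -> : (tperm i j * (u * v) = u * (tperm i j * v))%g.
      apply/permP => k; rewrite !permM.
      have [km|mk] := ltnP k m.
        have ks : tperm i j k = k by rewrite tpermD // -val_eqE /=; lia.
        have uk := ult _ km.
        have uks : tperm i j (u k) = u k by rewrite tpermD // -val_eqE /=; lia.
        by rewrite ks uks.
      by rewrite (um k) // um //; case: tpermP.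
    rewrite IH //.
      have := @card_ascents_tperm _ i j (tperm i j * v)%g ij.
      rewrite mulgA tperm2 mul1g !permM tpermL tpermR => /(_ vij) c.
      have := card_ascents_le (tperm i j * v)%g; move: uve; rewrite c.
      by move: #|ascents u| #|ascents v| 'C(n, 2) => x y z; lia.
    move=> k mk; rewrite permM tpermD ?vm //; rewrite -val_eqE /=; lia.
by rewrite mcoeffB rmorphM /= uv0 schubert_coef0 // subrr mpolyC0.
Qed.
End Support.

(** * Divided differences of flagged determinants *)

Section Flags.
Variable n : nat.
Implicit Types (i j k l : 'I_n) (w u v : 'S_n) (f g : {mpoly int[n]}).

(** [hz] expects an infinite sequence of variables; the default 0 is fixed by [msym], so [msym_xvar]
    holds for every index. *)
Definition xvar (i : nat) : {mpoly int[n]} :=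
  if insub i is Some o then 'X_o else 0.

Lemma xvarE i : xvar i = 'X_i.
Proof. by rewrite /xvar valK. Qed.

Lemma msym_xvar i j (a : nat) : msym (tperm i j) (xvar a) =
  xvar (if a == i then (j : nat) else if a == j then (i : nat) else a).
Proof.
rewrite {1}/xvar; case: insubP => [o _ oa|an].
  rewrite msymXU -oa !val_eqE; case: tpermP => [->|->|/eqP/negPf -> /eqP/negPf ->].
  - by rewrite eqxx xvarE.
  - by case: eqP => [->|_]; rewrite ?eqxx xvarE.
  - by rewrite xvarE.
have [ai|ai] := eqVneq a i; first by rewrite ai ltn_ord in an.
have [aj|aj] := eqVneq a j; first by rewrite aj ltn_ord in an.
by rewrite msym0 /xvar insubN.
Qed.

Lemma add_swap_eq (A : pzRingType) (a b h s t : A) :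
  t + a * h = s + b * h -> s = (a - b) * h + t.
Proof. by move=> e; apply: (addIr (b * h)); rewrite -e mulrBl addrAC subrK addrC. Qed.

(** Only row [rho] fails to be symmetric in ['X_i] and ['X_j], since [hz] with a flag other than i +
    1 contains both variables or neither. By linearity in that row, the divided difference acts
    there alone, raising the flag and lowering the degree by one. *)
Lemma divdiff_hz i j (p : nat) (rho : 'I_p) (phi phi' : 'I_p -> nat) (d d' : 'I_p ->
  int) :
  j = i.+1 :> nat -> phi rho = i.+1 -> phi' rho = i.+2 -> d' rho = d rho - 1 ->
  (forall a, a != rho -> [/\ phi a != i.+1, phi' a = phi a & d' a = d a]) ->
  divdiff i j (\det (\matrix_(a < p, c < p) hz xvar (phi a) (d a + c%:Z))) =
  \det (\matrix_(a < p, c < p) hz xvar (phi' a) (d' a + c%:Z)).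
Proof.
move=> ij phir phi'r d'r other; have ijN := neq_adj ij.
apply: divdiff_eq => //; set M' := \matrix_(_, _) _; set M := \matrix_(_, _) _.
pose y a := msym (tperm i j) (xvar a).
have yE a : y a = xvar (if a == i then (j : nat) else if a == j then (i : nat) else a)
  by apply: msym_xvar.
have swap a z : a != i.+1 -> hz y a z = hz xvar a z.
  move=> ai; have [ia|ia] := ltnP i.+1 a.
    by apply: (@hz_swap _ _ _ i) => // [b bi bj| |];
      rewrite yE -?ij ?eqxx // ?(negPf bi) ?ij ?(negPf bj) // ?gtn_eqF.
  apply: eq_hz => b ba; rewrite yE ij.
  by case: eqP => [|_]; [lia|case: eqP => //; lia].
pose N := map_mx (msym (tperm i j)) M.
have NE a c : N a c = hz y (phi a) (d a + c%:Z).
  by rewrite !mxE (rmorph_hz (msym (tperm i j))).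
have rowE (B B' C : 'M[{mpoly int[n]}]_p) e :
    (forall c, B rho c = e * B' rho c + C rho c) ->
    row rho B = e *: row rho B' + 1 *: row rho C.
  by move=> BE; apply/rowP => c; rewrite !mxE BE mul1r.
have := @determinant_multilinear _ _ M M' N rho ('X_i - 'X_j) 1.
rewrite mul1r => E; rewrite {1}E.
- by rewrite /N det_map_mx /= addrK.
- apply: rowE => c; rewrite NE [M _ _]mxE [M' _ _]mxE phir phi'r d'r.
  set z := d rho + c%:Z.
  have -> : d rho - 1 + c%:Z = z - 1 by rewrite /z; lia.
  (* The symmetric [hz] in i + 2 variables is split once along ['X_j] and once along ['X_i]; the
     difference of the two expansions is the claim. *)
  have e1 := hzS xvar i.+1 z; have e2 := hzS y i.+1 z.
  rewrite !(swap i.+2) ?gtn_eqF // in e2; rewrite e2 in e1.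
  have yi : y i.+1 = 'X_i by rewrite yE -ij eqxx gtn_eqF ?ij // xvarE.
  rewrite yi -ij xvarE in e1; rewrite -ij; exact: add_swap_eq e1.
- apply/matrixP => a c; rewrite !mxE;
  have /other[_ -> ->] // : lift rho a != rho by rewrite eq_sym neq_lift.
- apply/matrixP => a c; rewrite mxE NE !mxE swap //.
  by have /other[] : lift rho a != rho by rewrite eq_sym neq_lift.
Qed.

End Flags.

(** * From a dominant permutation to a shifted block *)

Section FlagShift.
Variable n : nat.
Implicit Types (w u v : 'S_n) (f g : {mpoly int[n]}).

Definition schubert_of (s : seq nat) f := forall w, oneline w = s -> schubert w = f.

Lemma schubert_of_swap (i j : 'I_n) s1 s2 a b f : j = i.+1 :> nat -> size s1 = i ->
  (a < b)%N -> schubert_of (s1 ++ b :: a :: s2) f ->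
  schubert_of (s1 ++ a :: b :: s2) (divdiff i j f).
Proof.
move=> ij s1i ab fP w ws.
have wi : (w i).+1 = a by rewrite -nth_oneline ws nth_cat s1i ltnn subnn.
have wj : (w j).+1 = b by rewrite -nth_oneline ws nth_cat s1i ij ltnNge leqnSn subSnn.
have wij : (w i < w j)%N by lia.
rewrite (schubert_ascent ij wij); congr divdiff; apply: fP.
exact: oneline_tperm ij s1i ws.
Qed.

(* Moving the value t + 1 to the left past the j-th letter of U shifts the j-th
   flag; at each moment exactly one row of the determinant has that flag. *)
Lemma schubert_move (m : nat) (U T : seq nat) (c : nat -> nat) :
  let p := size U in
  let D (t j : nat) := \det (\matrix_(a < p, b < p)
    hz (@xvar n) (a.+1 + (t + (j <= a)))%N ((c a)%:Z - a%:Z - (t + (j <= a))%:Z +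
      b%:Z)) in
  (m + size U + size T = n)%N ->
  (forall x, x \in U -> m < x)%N ->
  schubert_of (U ++ iota 1 m ++ T) (D 0%N p) ->
  schubert_of (iota 1 m ++ U ++ T) (D m p).
Proof.
move=> p D szn Um start.
(* The values 1, ..., t are already in front, and t + 1 has passed the letters of [U] from position
   j on; exactly the corresponding rows of [D t j] carry one extra shift. *)
pose L t j := iota 1 t ++ take j U ++ t.+1 :: drop j U ++ iota t.+2 (m - t.+1) ++ T.
have Q t : (t <= m)%N -> schubert_of (iota 1 t ++ U ++ iota t.+1 (m - t) ++ T) (D t p).
  elim: t => [|t IH] tm; first by rewrite subn0.
  have P j : (j <= p)%N -> schubert_of (L t (p - j)%N) (D t (p - j)%N).
    elim: j => [|j IHj] jp.
      rewrite subn0 /L take_size drop_size /=.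
      by have := IH (ltnW tm); rewrite -(subnSK tm).
    have {IHj} := IHj (ltnW jp).
    have pj : (p - j)%N = (p - j.+1).+1 by lia.
    move: (p - j.+1)%N pj => q pj; rewrite pj.
    have qp : (q < p)%N by lia.
    have tq : (t + q < n)%N by lia.
    have tq' : ((t + q).+1 < n)%N by move: szn; rewrite -/p; lia.
    pose i := Ordinal tq; pose i' := Ordinal tq'.
    have -> : L t q.+1 = (iota 1 t ++ take q U) ++
      nth 0%N U q :: t.+1 :: (drop q.+1 U ++ iota t.+2 (m - t.+1) ++ T).
      by rewrite /L (take_nth 0%N) // -cats1 -!catA.
    have -> : L t q = (iota 1 t ++ take q U) ++ t.+1 :: nth 0%N U q :: (drop q.+1 U ++
      iota t.+2 (m - t.+1) ++ T).
      by rewrite /L (drop_nth 0%N) // -!catA.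
    move=> H.
    have -> : D t q = divdiff i i' (D t q.+1).
      symmetry; apply: (@divdiff_hz n i i' p (Ordinal qp)
        (fun a => a.+1 + (t + (q.+1 <= a)))%N (fun a => a.+1 + (t + (q <= a)))%N
        (fun a => (c a)%:Z - a%:Z - (t + (q.+1 <= a))%:Z)
        (fun a => (c a)%:Z - a%:Z - (t + (q <= a))%:Z)) => //=.
      - by rewrite ltnn; lia.
      - by rewrite leqnn; lia.
      - by rewrite leqnn ltnn; lia.
      move=> a; rewrite -val_eqE /= => aq.
      by have [lt|gt|e] := ltngtP q a; [split; lia|split; lia|rewrite e eqxx in aq].
    apply: schubert_of_swap H => //=.
      by rewrite size_cat size_iota size_takel // ltnW.
    by have := Um (nth 0%N U q); rewrite mem_nth // => /(_ isT); lia.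
  have := P p (leqnn p); rewrite subnn /L take0 drop0 cat0s.
  have -> : D t 0%N = D t.+1 p.
    rewrite /D; apply: (congr1 determinant); apply/matrixP => a b.
    rewrite [LHS]mxE [RHS]mxE leq0n leqNgt ltn_ord.
    by rewrite addn0 addn1.
  have -> : iota 1 t.+1 = iota 1 t ++ [:: t.+1] by rewrite -[t.+1]addn1 iotaD add1n addn1.
  by rewrite -catA.
by have := Q m (leqnn m); rewrite subnn.
Qed.

(* The one-line word (values from 0) of the dominant permutation from which
   1^m x w0k(kb + r) x 1^c is reached by moving the values 0, ..., m - 1 to the
   front. *)
Definition dom_word (k b r m a : nat) : nat :=
  if (a < k * b)%N then (m + r + k * (b - (a %/ k).+1) + a %% k)%N
  else if (a < k * b + m + r)%N then (a - k * b)%N else a.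

(** Values increase inside a block and decrease from block to block, so the later smaller letters
    are exactly those below the minimum of the block containing [a]. *)
Lemma dom_word_code (k b r m a j : nat) : (0 < k)%N -> (a < k * b)%N ->
  ((a < j) && (dom_word k b r m j < dom_word k b r m a))%N =
  (dom_word k b r m j < m + r + k * (b - (a %/ k).+1))%N.
Proof.
move=> k0 akb; rewrite /dom_word akb.
have ea := divn_eq a k; have la := ltn_pmod a k0.
have ak : (a %/ k < b)%N by rewrite ltn_divLR // mulnC.
have [jkb|jkb] := ltnP j (k * b).
  have ej := divn_eq j k; have lj := ltn_pmod j k0.
  have jk : (j %/ k < b)%N by rewrite ltn_divLR // mulnC.
  move: ea ej la lj ak jk; move: (a %/ k)%N (a %% k)%N (j %/ k)%N (j %% k)%N => A a' J j'.
  move=> -> -> a'k j'k Ab Jb.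
  have [JA|AJ|->] := ltngtP J A.
  - have : (k * (b - A.+1) + k <= k * (b - J.+1))%N.
      by rewrite -mulnSr leq_mul2l; lia.
    by lia.
  - have h1 : (k * (b - J.+1) + k <= k * (b - A.+1))%N.
      by rewrite -mulnSr leq_mul2l; lia.
    have h2 : (A * k + k <= J * k)%N by rewrite -mulSnr leq_mul2r; lia.
    by lia.
  by lia.
have : (k * (b - (a %/ k).+1) + k <= k * b)%N.
  by rewrite -mulnSr leq_mul2l -subSn // subSS leq_subr orbT.
move: la akb jkb; move: (k * b)%N (k * (b - _))%N (a %% k)%N => K V a' la akb jkb VK.
by clear ea ak; case: (ltnP j (K + m + r)) => jm; lia.
Qed.

Lemma dom_word_code0 (k b r m a j : nat) : (k * b <= a)%N ->
  ((a < j) && (dom_word k b r m j < dom_word k b r m a))%N = false.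
Proof.
move=> akb; rewrite /dom_word; case: (ltnP a j) => //= aj.
rewrite (ltnNge a (k * b)) akb (ltnNge j (k * b)) (leq_trans akb (ltnW aj)) /=.
by case: (ltnP j (k * b + m + r)) => h1; case: (ltnP a (k * b + m + r)) => h2; lia.
Qed.

Lemma schubert_dom_word (k b r m : nat) w : (0 < k)%N -> (k * b + m + r <= n)%N ->
  (forall i : 'I_n, w i = dom_word k b r m i :> nat) ->
  schubert w = \prod_(a < k * b) xvar n a ^+ (m + r + k * (b - (a %/ k).+1)).
Proof.
move=> k0 len wE.
have V a : (a < k * b)%N -> (m + r + k * (b - (a %/ k).+1) <= n)%N.
  move=> akb; have : (k * (b - (a %/ k).+1) + k <= k * b)%N.
    have : (a %/ k < b)%N by rewrite ltn_divLR // mulnC.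
    by move=> ak; rewrite -mulnSr leq_mul2l -subSn // subSS leq_subr orbT.
  by move: (k * (b - _))%N (k * b)%N akb len => X K akb len; lia.
have cE i : code w i = if (i < k * b)%N then (m + r + k * (b - (i %/ k).+1))%N else 0%N.
  case: ltnP => ib.
    rewrite -[RHS](card_ord_lt (V _ ib)) -[RHS](card_preimset _ (@perm_inj _ w)).
    by apply: eq_card => j; rewrite !inE !wE dom_word_code.
  by apply/eqP; rewrite cards_eq0; apply/eqP/setP => j; rewrite !inE !wE dom_word_code0.
rewrite dominant_schubert => [|i j ij].
  have le : (k * b <= n)%N by lia.
  rewrite [RHS](big_ord_widen n (fun a => xvar n a ^+ (m + r + k *
    (b - (a %/ k).+1)))) //.
  rewrite big_mkcond /= [RHS]big_mkcond /=; apply: eq_bigr => i _; rewrite cE xvarE.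
  by case: ltnP.
rewrite !cE; case: ltnP => jb //; rewrite (leq_ltn_trans ij jb).
rewrite leq_add2l leq_mul2l; apply/orP; right; apply: leq_sub2l.
by rewrite ltnS leq_div2r.
Qed.
End FlagShift.

(** * Determinants of blocks and products over blocks *)

Section BlockWords.
Local Open Scope nat_scope.
Variable n : nat.
Implicit Types (w u v : 'S_n).

(** The word of 1^m x s padded by fixed points, so that all factors live in the same symmetric
    group. *)
Definition block_word (m : nat) (s : seq nat) : seq nat :=
  iota 1 m ++ [seq (x + m)%N | x <- s] ++ iota (m + size s).+1 (n - (m + size s)).

Lemma schubert_block (k b r m : nat) : r < k -> m + (k * b + r) <= n ->
  schubert_of (n := n) (block_word m (w0k k (k * b + r)))
   (\det (\matrix_(a < k * b, c < k * b)
      hz (xvar n) (m + a.+1) ((r + k * (b - (a %/ k).+1))%:Z - a%:Z + c%:Z)))%R.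
Proof.
move=> rk mn; have k0 : 0 < k by lia.
set N := k * b + r in mn *.
pose U := [seq (dom_word k b r m a).+1 | a <- iota 0 (k * b)].
pose T := iota m.+1 r ++ iota (m + N).+1 (n - (m + N)).
have sU : size U = k * b by rewrite size_map size_iota.
have -> : block_word m (w0k k N) = iota 1 m ++ U ++ T.
  rewrite /block_word size_w0k // -/N; congr (_ ++ _).
  rewrite /T w0kE // map_cat -catA map_addn_iota add1n; congr (_ ++ _).
  rewrite /U iota_blocks !map_flatten -!map_comp; congr flatten.
  rewrite -[1]addn0 iotaDl -map_comp; apply/eq_in_map => I; rewrite mem_iota /= => Ib.
  rewrite add1n map_addn_iota -[(_ - _).+1 + m]addn0 -[k * I]addn0 !iotaDl -map_comp.
  apply/eq_in_map => al; rewrite mem_iota /= => alk.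
  have lt : k * I + al < k * b.
    by apply: (@leq_trans (k * I.+1)); [rewrite mulnS; lia|rewrite leq_mul2l; lia].
  rewrite /dom_word lt [k * I]mulnC divnMDl // divn_small // addn0 modnMDl modn_small //.
  have : k * b = k * (b - I.+1) + k * I.+1 by rewrite -mulnDr subnK //.
  move=> ->; move: (k * (b - _)) (k * _.+1) => X Y; lia.
(* The code of the dominant word; its summand [m] is what the [m] shifts will take off the
   degrees. *)
pose c a := m + r + k * (b - (a %/ k).+1).
have := @schubert_move n m U T c; rewrite /= sU => H.
set D := (\det _)%R; have -> : D = (\det (\matrix_(a < k * b, b0 < k * b)
    hz (xvar n) (a.+1 + (m + (k * b <= a))) ((c a)%:Z - a%:Z - (m + (k *
      b <= a))%:Z + b0%:Z)))%R.
  apply: (congr1 determinant); apply/matrixP => i j; rewrite [LHS]mxE [RHS]mxE.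
  rewrite [in RHS]leqNgt ltn_ord addn0 addnC; congr hz.
  by rewrite /c; move: (k * _) => X; lia.
apply: H.
- by rewrite size_cat !size_iota /N; lia.
- move=> x /mapP[a]; rewrite mem_iota add0n => /andP[_ akb] ->.
  by rewrite ltnS /dom_word akb -!addnA leq_addr.
have -> : (\det (\matrix_(a < k * b, b0 < k * b)
    hz (xvar n) (a.+1 + (0 + (k * b <= a))) ((c a)%:Z - a%:Z - (0 + (k *
      b <= a))%:Z + b0%:Z)))%R
   = (\prod_(a < k * b) xvar n a ^+ c a)%R.
  rewrite -det_hz; apply: (congr1 determinant); apply/matrixP => i j;
    rewrite [LHS]mxE [RHS]mxE.
  by rewrite [in LHS]leqNgt ltn_ord !addn0 subr0.
move=> w we; apply: schubert_dom_word => //; first by lia.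
move=> i; apply: succn_inj; rewrite -nth_oneline we nth_cat sU.
have lin := ltn_ord i.
case: ltnP => ikb; first by rewrite (nth_map 0) ?size_iota // nth_iota.
rewrite /T catA -[m.+1]add1n -iotaD nth_cat size_iota /dom_word [i < k * b]ltnNge ikb /=.
case: (ltnP (i - k * b)) => im; first by rewrite nth_iota // ifT; lia.
rewrite ifF; last by lia.
by rewrite nth_iota; rewrite /N; lia.
Qed.

Lemma schubert_direct_prod (m : nat) s t u v w :
  is_word s -> size s = m -> oneline w = direct_prod s t ->
  oneline u = s ++ iota m.+1 (n - m) ->
  oneline v = iota 1 m ++ [seq (x + m)%N | x <- t] ->
  (schubert w = schubert u * schubert v)%R.
Proof.
move=> sP sm wE uE vE.
have um (i : 'I_n) : m <= i -> u i = i.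
  move=> mi; apply: val_inj; apply: succn_inj; have lin := ltn_ord i.
  by rewrite -nth_oneline uE nth_cat sm ltnNge mi /= nth_iota; lia.
have vm (i : 'I_n) : i < m -> v i = i.
  move=> im; apply: val_inj; apply: succn_inj.
  by rewrite -nth_oneline vE nth_cat size_iota im nth_iota // add1n.
rewrite -(schubertM um vm); congr schubert.
apply/permP => i; apply: val_inj; apply: succn_inj; rewrite permM.
rewrite -nth_oneline wE /direct_prod nth_cat sm.
have [im|mi] := ltnP i m.
  rewrite vm; first by rewrite -nth_oneline uE nth_cat sm im.
  suff: (u i).+1 \in s by rewrite (perm_mem sP) sm mem_iota add1n ltnS.
  by rewrite -nth_oneline uE nth_cat sm im mem_nth // sm.
by rewrite um // -nth_oneline vE nth_cat size_iota ltnNge mi.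
Qed.

Fixpoint prod_blocks (A : comNzRingType) (f : nat -> seq nat -> A) (t : seq nat)
    (m : nat) (ss : seq (seq nat)) : A :=
  if ss is s :: ss' then (f m s * prod_blocks f t (m + size s) ss')%R else f m t.

Lemma schubert_foldr (A : comNzRingType) (phi : {rmorphism {mpoly int[n]} -> A})
    (f : nat -> seq nat -> A) t ss :
  all is_word ss -> is_word t ->
  (forall m s w, s \in t :: ss -> m + size s <= n ->
     oneline w = block_word m s -> phi (schubert w) = f m s) ->
  forall m w, m + size (foldr direct_prod t ss) = n ->
  oneline w = iota 1 m ++ [seq (x + m)%N | x <- foldr direct_prod t ss] ->
  phi (schubert w) = prod_blocks f t m ss.
Proof.
move=> + tP; elim: ss => [|s ss IH] ssP fP m w szn.
  move=> wE; apply: (fP m t); rewrite ?mem_head ?szn //.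
  by rewrite /block_word szn subnn cats0.
have /andP[sP {}ssP] := ssP.
move=> we; rewrite /= /direct_prod size_cat size_map in szn.
pose p := iota 1 m ++ [seq (x + m)%N | x <- s].
have sp : size p = m + size s by rewrite size_cat size_iota size_map.
have pP : is_word p.
  by have := @is_word_direct_prod (iota 1 m) s; rewrite /direct_prod size_iota;
    apply => //; rewrite /is_word size_iota.
have wE : oneline w = direct_prod p (foldr direct_prod t ss).
  rewrite we /= /direct_prod map_cat catA -/p sp -map_comp; congr (_ ++ _).
  by apply: eq_map => x /=; lia.
have wP := is_word_oneline w.
have nE : iota 1 n = iota 1 (m + size s) ++ iota (m + size s).+1 (n - (m + size s)).
  by rewrite -add1n -iotaD; congr iota; lia.
have pP' : perm_eq p (iota 1 (m + size s)) by rewrite -sp.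
have [u uE] : exists u : 'S_n, oneline u = p ++ iota (m + size s).+1 (n - (m + size s)).
  by apply: oneline_onto; rewrite nE perm_cat2r.
have [v vE] : exists v : 'S_n, oneline v =
    iota 1 (m + size s) ++ [seq (x + (m + size s))%N | x <- foldr direct_prod t ss].
  apply: oneline_onto; apply: perm_trans wP; rewrite wE /direct_prod sp.
  by rewrite perm_cat2r perm_sym.
rewrite (schubert_direct_prod pP sp wE uE vE) rmorphM /=; congr (_ * _)%R.
  by apply: (fP m s); [rewrite !inE eqxx orbT|rewrite -szn leq_add2l leq_addr|rewrite
    /block_word catA].
apply: (IH ssP) => //; last by rewrite -addnA szn.
by move=> m' s' w'; rewrite inE => /orP[/eqP ->|s'ss]; apply: fP;
  rewrite !inE ?eqxx // s'ss !orbT.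
Qed.
End BlockWords.

Lemma schubert_eval_multi_layered (A : comNzRingType) (x : nat -> A)
    (k b r n : nat) (bs : seq nat) (w : 'S_n) :
  (r < k)%N -> n = (k * (sumn bs + b) + r)%N ->
  oneline w = foldr direct_prod (w0k k (k * b + r)) [seq w0k k (k * b') | b' <- bs] ->
  schubert_eval x w = multi_layered_det x k b r 0 bs.
Proof.
move=> rk nE wE; pose phi :=
  mmap intr (fun i : 'I_n => x i) : {rmorphism {mpoly int[n]} -> A}.
have k0 : (0 < k)%N by lia.
have sz0 b' : size (w0k k (k * b')) =
  (k * b')%N by rewrite -[X in w0k k X]addn0 size_w0k ?addn0.
have w00 b' : is_word (w0k k (k * b')) by rewrite -[X in w0k k X]addn0;
  apply: is_word_w0k.
(* [schubert_foldr] passes blocks as words, so their parameters are recovered from the size by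
   division by [k]. *)
pose f m (s : seq nat) := block_det x k (size s %/ k) (size s %% k) m.
have fE m (s : seq nat) u : (s \in w0k k (k * b + r) :: [seq w0k k (k * b') |
  b' <- bs])%N ->
    (m + size s <= n)%N -> oneline u = block_word n m s -> phi (schubert u) = f m s.
  move=> sin; have [b' [r' [r'k ->]]] : exists b' r', (r' < k)%N /\ s =
    w0k k (k * b' + r').
    move: sin; rewrite inE => /orP[/eqP ->|/mapP[b' _ ->]]; first by exists b, r.
    by exists b', 0%N; rewrite addn0.
  rewrite size_w0k // => mn uE; rewrite (schubert_block r'k mn uE) /f size_w0k //.
  rewrite [(k * b')%N]mulnC divnMDl // divn_small // addn0 modnMDl modn_small // [(b' *
    k)%N]mulnC.
  rewrite -det_map_mx; apply: (congr1 determinant); apply/matrixP => i j;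
    rewrite !mxE rmorph_hz.
  apply: eq_hz => c cm; have cn : (c < n)%N by have := ltn_ord i; lia.
  by rewrite /= (xvarE (Ordinal cn)) /phi /= mmapX mmap1U.
have szf : size (foldr direct_prod (w0k k (k * b + r)) [seq w0k k (k * b') |
  b' <- bs]) = n.
  rewrite nE; elim: (bs) => [|b' bs' IH] /=; first by rewrite size_w0k.
  by rewrite /direct_prod size_cat size_map IH sz0 !mulnDr !addnA.
have wE0 : oneline w =
  iota 1 0 ++ [seq (y + 0)%N |
    y <- foldr direct_prod (w0k k (k * b + r)) [seq w0k k (k * b') | b' <- bs]].
  by rewrite wE /= -[LHS]map_id; apply: eq_map => y /=; rewrite addn0.
rewrite -[LHS]/(phi (schubert w)) (schubert_foldr _ _ fE _ wE0) //.
- elim: (bs) {wE fE szf wE0 nE} 0%N => [|b' bs' IH] m /=.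
    by rewrite /f size_w0k // [(k *
      b)%N]mulnC divnMDl // divn_small // addn0 modnMDl modn_small.
  by rewrite IH /f sz0 mulKn // modnMr.
- by apply/allP => s /mapP[b' _ ->].
- exact: is_word_w0k.
Qed.

End SchubertTheory.

Lemma multi_layered_onto (k b r n : nat) (bs : seq nat) :
  (r < k)%N -> n = (k * (sumn bs + b) + r)%N ->
  exists w : 'S_n,
  oneline w = foldr direct_prod (w0k k (k * b + r)) [seq w0k k (k * b') | b' <- bs].
Proof.
move=> rk nE; apply: oneline_onto.
have sz0 b' : size (w0k k (k * b')) = (k * b')%N.
  by rewrite -[X in w0k k X]addn0 size_w0k ?addn0 //; lia.
set s := foldr _ _ _; have sn : size s = n.
  rewrite nE /s; elim: (bs) => [|b' bs' IH] /=; first by rewrite size_w0k.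
  by rewrite /direct_prod size_cat size_map IH sz0 !mulnDr !addnA.
rewrite -sn; apply: is_word_foldr; last exact: is_word_w0k.
apply/allP => _ /mapP[b' _ ->].
by rewrite -[X in w0k k X]addn0; apply: is_word_w0k; lia.
Qed.

(** * Specialization at a root of unity *)

Section Determinants.
Variable A : comNzRingType.

Lemma det_mxsub_inj (n : nat) (f g : 'I_n -> 'I_n) (finj : injective f)
    (ginj : injective g) (M : 'M[A]_n) :
  \det (mxsub f g M) = (-1) ^+ (perm finj (+) perm ginj)%g * \det M.
Proof.
have -> : mxsub f g M = row_perm (perm finj) (col_perm (perm ginj) M).
  by apply/matrixP => i j; rewrite !mxE !permE.
rewrite row_permE col_permE !det_mulmx !det_perm signr_addb.
by rewrite odd_permV [X in _ * X]mulrC mulrA.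
Qed.

Lemma det_mxsub_same (n : nat) (f : 'I_n -> 'I_n) (finj : injective f) (M : 'M[A]_n) :
  \det (mxsub f f M) = \det M.
Proof. by rewrite (det_mxsub_inj finj finj) addbb mul1r. Qed.

Lemma det_block_trig (k b : nat) (G : nat -> nat -> nat -> nat -> A) :
  (forall a c i j, (c < a < k)%N -> G a c i j = 0) ->
  \det (\matrix_(p < k * b, q < k * b) G (p %/ b)%N (q %/ b)%N (p %% b)%N (q %% b)%N) =
  \prod_(a < k) \det (\matrix_(i < b, j < b) G a a i j).
Proof.
elim: k G => [|k IH] G G0.
  by rewrite big_ord0; apply: det_mx00.
case: b IH => [|b] IH.
  rewrite big1 => [|a _]; last exact: det_mx00.
  by move: (\matrix_(_, _) _); rewrite muln0 => M; apply: det_mx00.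
rewrite mulSn big_ord_recl -(IH (fun a c => G a.+1 c.+1)); last by move=> a c i j ca;
  apply: G0.
rewrite -(det_ublock _ (\matrix_(p < b.+1, q < k *
  b.+1) G 0%N (q %/ b.+1).+1 p (q %% b.+1)%N)).
apply: (congr1 determinant); apply/matrixP => p q; rewrite [LHS]mxE.
have E0 (i : 'I_b.+1) : (i %/ b.+1 = 0)%N /\ (i %% b.+1 = i)%N.
  by rewrite divn_small ?modn_small.
have E1 (i : nat) : ((b.+1 + i) %/ b.+1 = (i %/ b.+1).+1)%N /\ ((b.+1 + i) %% b.+1 =
  i %% b.+1)%N.
  by rewrite divnDl ?dvdnn // divnn modnDl.
rewrite -(splitK p) -(splitK q); case: (split p) => i; case: (split q) => j /=.
- by rewrite block_mxEul mxE; have [-> ->] := E0 i; have [-> ->] := E0 j.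
- by rewrite block_mxEur mxE; have [-> ->] := E0 i; have [-> ->] := E1 j.
- by rewrite block_mxEdl mxE; have [-> ->] := E1 i; have [-> ->] := E0 j;
  rewrite G0 //= ltnS ltn_divLR.
- by rewrite block_mxEdr mxE; have [-> ->] := E1 i; have [-> ->] := E1 j.
Qed.
End Determinants.

(** The value of h_z at s + 1 variables equal to 1; [binzS] is the corresponding case of [hzS]. *)
Definition binz (z : int) (s : nat) : nat := if z is Posz r then 'C(r + s, s) else 0%N.

Lemma binz_lt0 z s : z < 0 -> binz z s = 0%N.
Proof. by case: z. Qed.

Lemma binz0 z : binz z 0 = (0 <= z) :> nat.
Proof. by case: z => // r; rewrite /= bin0. Qed.

Lemma binzS z s : binz z s.+1 = (binz z s + binz (z - 1) s.+1)%N.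
Proof.
case: z => [[|r]|r]; last by rewrite !binz_lt0 //; lia.
  by rewrite [X in (_ + X)%N]binz_lt0 //= !binn.
have -> : r.+1%:Z - 1 = r by lia.
by rewrite /= addnS binS addSn addnC addnS.
Qed.

(** * A Lucas-type factorization of complete symmetric polynomials *)

Section RootsOfUnity.
Variables (A : fieldType) (k : nat) (q : A).
Hypothesis qP : k.-primitive_root q.
Implicit Types (z R : int) (s S : nat).

Let x (i : nat) : A := q ^+ i.
Let k0 : (0 < k)%N. Proof. exact: prim_order_gt0 qP. Qed.

(* Multiplying the generating function of the h_z(y_0, ..., y_(s+d-1)) by
   prod_i (1 - y_(s+i) t); the polynomial P is the reversed product. *)
Lemma hz_act (y : nat -> A) s d (P := \prod_(0 <= i < d) ('X - (y (s + i)%N)%:P)) z :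
  hz y s (z + d%:Z) = \sum_(l < d.+1) P`_l * hz y (s + d) (z + l%:Z).
Proof.
rewrite {}/P; elim: d z => [|d IH] z.
  by rewrite big_geq // big_ord1 coef1 mul1r !addr0 addn0.
have -> : z + d.+1%:Z = z + 1 + d%:Z by lia.
rewrite IH big_nat_recr //=; set P := \prod_(0 <= i < d) _.
have szP : (size P <= d.+1)%N.
  rewrite /P; elim: (d) => [|d' IHd]; first by rewrite big_geq // size_poly1.
  rewrite big_nat_recr //=; apply: leq_trans (size_polyMleq _ _) _.
  by rewrite size_XsubC addnS /= addn1.
rewrite mulrBr (eq_bigr (fun l : 'I_d.+2 => (if l == 0%N :> nat then 0 else P`_l.-1) *
  hz y (s + d.+1) (z + l%:Z)
   - P`_l * (y (s + d)%N * hz y (s + d.+1) (z + l%:Z)))); last first.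
  by move=> l _; rewrite coefB coefMX coefMC mulrBl mulrA.
rewrite sumrB [in X in _ = X - _]big_ord_recl /= mul0r add0r [in X in _ =
  _ - X]big_ord_recr /=.
rewrite [P`_d.+1]nth_default // mul0r addr0 -sumrB; apply: eq_bigr => l _.
rewrite -mulrBr; congr (_ * _); rewrite addnS.
have -> : z + (bump 0 l)%:Z = z + 1 + l%:Z by rewrite /bump /=; lia.
rewrite hzS; have -> : z + 1 + l%:Z - 1 = z + l%:Z by lia.
by rewrite addrK.
Qed.

(** The [k] added variables are all the k-th roots of unity. Their polynomial is X^k - 1, so only
    two terms of [hz_act] survive. *)
Lemma hz_period s z : hz x (k * s) (z + k%:Z) =
  hz x (k * s + k) (z + k%:Z) - hz x (k * s + k) z.
Proof.
rewrite hz_act.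
have -> : \prod_(0 <= i < k) ('X - (x (k * s + i)%N)%:P) = 'X^k - 1.
  rewrite -(factor_Xn_sub_1 qP); apply: eq_big_nat => i _.
  by rewrite /x exprD mulnC exprM -exprM mulnC exprM (prim_expr_order qP) expr1n mul1r.
rewrite big_ord_recr /= coefB coefXn coef1 eqxx (gtn_eqF k0) subr0 mul1r.
rewrite addrC; congr (_ + _).
case: k k0 => // k' _; rewrite big_ord_recl big1 ?addr0 => [|l _].
  by rewrite coefB coefXn coef1 /= sub0r mulN1r; congr (- hz _ _ _); lia.
by rewrite coefB coefXn coef1 /= /bump /= ltn_eqF ?subr0 ?mul0r //= ltnS.
Qed.

(** Over S + 1 full periods the generating function is 1/(1 - t^k)^(S+1). *)
Lemma hz_full S R c : (c < k)%N ->
  hz x (k * S.+1) (k%:Z * R + c%:Z) = ((c == 0%N) * binz R S)%N%:R.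
Proof.
move=> ck; have step s z : hz x (k * s.+1) z =
  hz x (k * s) z + hz x (k * s.+1) (z - k%:Z).
  have := hz_period s (z - k%:Z); rewrite subrK mulnSr => ->.
  by rewrite subrK.
have lt0 R' : R' < 0 -> k%:Z * R' + c%:Z < 0.
  by case: R' => // r _; rewrite NegzE; nia.
elim: S R => [|S IHS] R; elim/int_ind_ge0: R => R H;
  try by rewrite hz_lt0 ?lt0 // binz_lt0 // muln0.
- rewrite step muln0 hz0.
  have -> : k%:Z * R + c%:Z - k%:Z = k%:Z * (R - 1) + c%:Z by lia.
  rewrite H -natrD !binz0; congr (_%:R).
  have [->|c0] := eqVneq c 0%N.
    rewrite addr0 mulf_eq0 !mul1n; have -> : (k%:Z == 0) = false by apply/eqP; lia.
    by rewrite /=; lia.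
  rewrite !mul0n addn0; case: eqP => // e; exfalso.
  case: R e {H} => r; first by nia.
  by move=> e; have := lt0 (Negz r) isT; rewrite e.
- rewrite step IHS.
  have -> : k%:Z * R + c%:Z - k%:Z = k%:Z * (R - 1) + c%:Z by lia.
  by rewrite H -natrD -mulnDr -binzS.
Qed.

(* T d c is the coefficient of t^(c - (k-1-d)) in prod_(k-1-d < i < k) (1 - q^i t). *)
Fixpoint q_coef (d c : nat) : A :=
  if d is d'.+1 then q_coef d' c.+1 - q ^+ (k - d'.+1) * q_coef d' c
  else (c == k.-1)%:R.

Lemma q_coef_ge d c : (k <= c)%N -> q_coef d c = 0.
Proof.
elim: d c => [|d IH] c kc /=; first by rewrite gtn_eqF // (leq_trans _ kc) // prednK.
by rewrite !IH ?mulr0 ?subr0 // leqW.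
Qed.

Lemma q_coef_lt d c : (c + d < k.-1)%N -> q_coef d c = 0.
Proof.
elim: d c => [|d IH] c kc /=; first by rewrite ltn_eqF //; lia.
by rewrite !IH ?mulr0 ?subr0 //; lia.
Qed.

Lemma q_coef_diag d : (d < k)%N -> q_coef d (k.-1 - d) = 1.
Proof.
elim: d => [|d IH] dk /=; first by rewrite subn0 eqxx.
rewrite [X in _ * X]q_coef_lt ?mulr0 ?subr0; last by lia.
by rewrite -[RHS](IH (ltnW dk)); congr q_coef; lia.
Qed.

(** The induction starts at a full number of periods, where [hz_full] applies, and removes one
    variable at a time: [hzS] then becomes the recurrence defining [q_coef]. *)
Lemma hz_lucas_rev d c S R : (d < k)%N -> (c < k)%N ->
  hz x (k * S + (k - d)) (k%:Z * R + c%:Z - (k.-1 - d)%:Z) = q_coef d c * (binz R S)%:R.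
Proof.
elim: d c R => [|d IH] c R dk ck.
  rewrite subn0 -mulnSr subn0 /=; have [->|ck1] := eqVneq c k.-1.
    have -> : k%:Z * R + (k.-1)%:Z - (k.-1)%:Z = k%:Z * R + 0%N%:Z by lia.
    by rewrite hz_full // mul1n mul1r.
  have -> : k%:Z * R + c%:Z - (k.-1)%:Z = k%:Z * (R - 1) + c.+1%:Z by lia.
  by rewrite hz_full ?mul0n ?mul0r //; lia.
have a0 : (0 < k - d.+1)%N by lia.
have dk' : (d < k)%N by lia.
have ha := hzS x (k * S + (k - d.+1)) (k%:Z * R + c%:Z - (k.-1 - d.+1)%:Z).
have e1 : (k * S + (k - d.+1)).+1 = (k * S + (k - d))%N by lia.
have e2 : k%:Z * R + c%:Z - (k.-1 - d.+1)%:Z - 1 = k%:Z * R + c%:Z - (k.-1 - d)%:Z by lia.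
have e3 : k%:Z * R + c%:Z - (k.-1 - d.+1)%:Z = k%:Z * R + c.+1%:Z - (k.-1 - d)%:Z by lia.
rewrite e1 e2 [in X in X = _]e3 in ha.
have {ha} -> : hz x (k * S + (k - d.+1)) (k%:Z * R + c%:Z - (k.-1 - d.+1)%:Z) =
  hz x (k * S + (k - d)) (k%:Z * R + c.+1%:Z - (k.-1 - d)%:Z)
  - x (k * S + (k - d.+1)) * hz x (k * S + (k - d)) (k%:Z * R + c%:Z - (k.-1 - d)%:Z).
  by rewrite ha addrK.
rewrite (IH c) //= mulrBl; congr (_ - _); last first.
  rewrite mulrA; congr (_ * _ * _); rewrite /x exprD exprM (prim_expr_order qP).
  by rewrite expr1n mul1r.
have [ck'|] := ltnP c.+1 k; first by rewrite IH.
rewrite leq_eqVlt ltnS leqNgt ck orbF => /eqP kc.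
(* The residue c + 1 = k wraps to 0 with quotient R + 1. This is harmless, since [q_coef] vanishes
   both at 0 and at k. *)
have -> : k%:Z * R + c.+1%:Z - (k.-1 - d)%:Z =
  k%:Z * (R + 1) + 0%N%:Z - (k.-1 - d)%:Z by lia.
by rewrite IH // q_coef_lt ?q_coef_ge ?mul0r //; lia.
Qed.

Lemma hz_lucas a c S R : (a < k)%N -> (c < k)%N ->
  hz x (k * S + a.+1) (k%:Z * R + c%:Z - a%:Z) = q_coef (k.-1 - a) c * (binz R S)%:R.
Proof.
move=> ak ck; rewrite -hz_lucas_rev //; last by lia.
by congr (hz _ (_ + _) (_ - _)); lia.
Qed.

End RootsOfUnity.

(* The value at 1 of the Schubert polynomial of 1^M x w0(b). *)
Definition Fdet (M b : nat) : int :=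
  \det (\matrix_(i < b, j < b) ('C(M + (b - i.+1) + j, M + i))%:Z).

(** The last row of the larger matrix is (0, ..., 0, 1). Thus a block whose degrees are raised by
    one, as happens for residues below [r], is read as F(M,b+1). *)
Lemma Fdet_succ M b :
  \det (\matrix_(i < b, j < b) ('C(M + (b - i) + j, M + i))%:Z) = Fdet M b.+1.
Proof.
rewrite /Fdet (expand_det_row _ ord_max) (bigD1 ord_max) //= big1 ?addr0 => [|j jm].
  rewrite mxE /= subnn addn0 binn mul1r /cofactor -signr_odd oddD addbb mul1r.
  apply: (congr1 determinant); apply/matrixP => i j; rewrite !mxE /= /bump.
  by rewrite !(leqNgt b) !ltn_ord !add0n subSS.
rewrite mxE /= subnn addn0 bin_small ?mul0r // ltn_add2l.
by have := ltn_ord j; move: jm; rewrite -val_eqE /=; lia.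
Qed.

Lemma binz_nat (M b i j e : nat) : (i < b)%N ->
  binz ((b - i.+1)%N%:Z - i%:Z + j%:Z + e%:Z) (M + i) = 'C(M + (b - i.+1) + j + e, M + i).
Proof.
move=> ib; case E: (_ - _ + _ + _) => [r|r]; last by rewrite bin_small //; lia.
by rewrite /=; congr 'C(_, _); lia.
Qed.

Lemma prod_ltn_if (A : comNzRingType) (x y : A) r k : (r <= k)%N ->
  \prod_(a < k) (if (a < r)%N then x else y) = x ^+ r * y ^+ (k - r).
Proof.
move=> rk; have [d ->] : exists d, k = (r + d)%N by exists (k - r)%N; lia.
rewrite addKn big_split_ord /=.
rewrite (eq_bigr (fun=> x)) => [|a _]; last by rewrite ltn_ord.
rewrite [X in _ * X](eq_bigr (fun=> y)) => [|a _]; last by rewrite ltnNge leq_addr.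
by rewrite !prodr_const !card_ord.
Qed.

(** * Block determinants at a root of unity *)

Section BlockDet.
Variables (A : fieldType) (k : nat) (q : A).
Hypothesis qP : k.-primitive_root q.

(** Grouping rows and columns by residue makes the matrix block triangular, with diagonal blocks of
    plain binomials. The sign is tracked because [v] is defined without a modulus; for r = 0 both
    reorderings coincide and it disappears. *)
Lemma block_detE (M b r : nat) : (r < k)%N -> exists e : bool,
  (r = 0%N -> e = false) /\
  block_det (fun i => q ^+ i) k b r (k * M) =
  (-1) ^+ e * ((Fdet M b) ^+ (k - r) * (Fdet M b.+1) ^+ r)%:~R.
Proof.
move=> rk; have k0 : (0 < k)%N by lia.
have dvk i a : (a < k)%N -> ((k * i + a) %/ k = i)%N.
  by move=> ak; rewrite mulnC divnMDl // divn_small ?addn0.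
have mdk i a : (a < k)%N -> ((k * i + a) %% k = a)%N.
  by move=> ak; rewrite mulnC modnMDl modn_small.
case: b => [|b].
  exists false; split=> //; rewrite /block_det mul1r.
  have -> : Fdet M 0 = 1 by apply: det_mx00.
  have -> : Fdet M 1 = 1.
    by rewrite /Fdet det_mx11 mxE /= subnn !addn0 binn.
  rewrite !expr1n mulr1.
  by move: (\matrix_(_, _) _); rewrite muln0 => N; apply: det_mx00.
have ltf (p : 'I_(k * b.+1)) : (k * (p %% b.+1) + p %/ b.+1 < k * b.+1)%N.
  have : (p %/ b.+1 < k)%N by rewrite ltn_divLR.
  have : (p %% b.+1 <= b)%N by rewrite -ltnS ltn_pmod.
  move: (p %% b.+1)%N (p %/ b.+1)%N => i a ib ak.
  by apply: (@leq_trans (k * i.+1)); [rewrite mulnS; lia|rewrite leq_mul2l ltnS ib orbT].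
have ltg (p : 'I_(k * b.+1)) :
    (k * (p %% b.+1) + (p %/ b.+1 + (k - r)) %% k < k * b.+1)%N.
  have : ((p %/ b.+1 + (k - r)) %% k < k)%N by rewrite ltn_pmod.
  have : (p %% b.+1 <= b)%N by rewrite -ltnS ltn_pmod.
  move: (p %% b.+1)%N (_ %% k)%N => i a ib ak.
  by apply: (@leq_trans (k * i.+1)); [rewrite mulnS; lia|rewrite leq_mul2l ltnS ib orbT].
(* Columns are rotated by -r to absorb the [r] in the degrees: in residue class c the quotient
   becomes j, or j + 1 when c < r. *)
pose f p := Ordinal (ltf p); pose g p := Ordinal (ltg p).
have finj : injective f.
  move=> p p' /(congr1 val) /= e.
  have ap : (p %/ b.+1 < k)%N by rewrite ltn_divLR.
  have ap' : (p' %/ b.+1 < k)%N by rewrite ltn_divLR.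
  have e1 := congr1 (modn^~ k) e; have e2 := congr1 (divn^~ k) e.
  rewrite /= !mdk // in e1; rewrite /= !dvk // in e2.
  by apply: val_inj; rewrite /= (divn_eq p b.+1) (divn_eq p' b.+1) e1 e2.
have ginj : injective g.
  move=> p p' /(congr1 val) /= e.
  have ap : (p %/ b.+1 < k)%N by rewrite ltn_divLR.
  have ap' : (p' %/ b.+1 < k)%N by rewrite ltn_divLR.
  have e1 := congr1 (modn^~ k) e; have e2 := congr1 (divn^~ k) e.
  rewrite /= !mdk ?ltn_pmod // in e1; rewrite /= !dvk ?ltn_pmod // in e2.
  move/eqP: e1; rewrite eqn_modDr (modn_small ap) (modn_small ap') => /eqP e1.
  by apply: val_inj; rewrite /= (divn_eq p b.+1) (divn_eq p' b.+1) e1 e2.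
pose e := (perm finj (+) perm ginj)%g : bool.
exists e; split=> [r0|].
  rewrite /e (_ : perm ginj = perm finj) ?addbb //; apply/permP => p; rewrite !permE.
  by apply: val_inj; rewrite /= r0 subn0 modnDr (@modn_small _ k) // ltn_divLR.
rewrite /block_det; set N := \matrix_(_, _) _.
have -> : \det N = (-1) ^+ e * \det (mxsub f g N).
  by rewrite det_mxsub_inj mulrA -signr_addb addbb mul1r.
congr (_ * _).
pose G a c i j := q_coef k q (k.-1 - a) c *
  ('C(M + (b.+1 - i.+1) + j + (c < r)%N, M + i))%:R.
have -> : mxsub f g N = \matrix_(p < k * b.+1, p' < k * b.+1)
   G (p %/ b.+1)%N (p' %/ b.+1)%N (p %% b.+1)%N (p' %% b.+1)%N.
  apply/matrixP => p p'; rewrite !mxE /=.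
  have ap : (p %/ b.+1 < k)%N by rewrite ltn_divLR.
  have ap' : (p' %/ b.+1 < k)%N by rewrite ltn_divLR.
  have ip : (p %% b.+1 < b.+1)%N by rewrite ltn_pmod.
  move: (p %/ b.+1)%N (p' %/ b.+1)%N (p %% b.+1)%N (p' %% b.+1)%N ap ap' ip => a c i j
    ak ck ib.
  rewrite /G -binz_nat // -(hz_lucas qP) //.
  rewrite dvk //.
  congr hz; first by rewrite mulnDr; lia.
  have -> : ((c + (k - r)) %% k)%N = (c + k * (c < r) - r)%N.
    case: ltnP => cr; first by rewrite modn_small; lia.
    have -> : (c + (k - r) = k + (c - r))%N by lia.
    by rewrite modnDl modn_small; lia.
  rewrite [(k * j + _)%N%:Z]PoszD;
    have -> : (c + k * (c < r) - r)%N%:Z = c%:Z + k%:Z * (c < r)%N%:Z - r%:Z.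
    by case: ltnP; lia.
  move: (c < r)%N (b.+1 - i.+1)%N => d u; rewrite !PoszD !PoszM; ring.
rewrite det_block_trig => [|a c i j /andP[ca ak]];
  last by rewrite /G q_coef_lt ?mul0r //; lia.
rewrite rmorphM !rmorphXn /= mulrC -prod_ltn_if ?(ltnW rk) //; apply: eq_bigr => a _.
have qa : q_coef k q (k.-1 - a)%N a = 1.
  have ak := ltn_ord a; rewrite -[RHS](@q_coef_diag _ k q qP (k.-1 - a)%N); last by lia.
  by congr q_coef; lia.
have -> : (if (a < r)%N then (Fdet M b.+2)%:~R else (Fdet M b.+1)%:~R) =
   (if (a < r)%N then Fdet M b.+2 else Fdet M b.+1)%:~R :> A by case: ifP.
have -> : (if (a < r)%N then Fdet M b.+2 else Fdet M b.+1) =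
   \det (\matrix_(i < b.+1, j < b.+1) ('C(M + (b.+1 - i.+1) + j + (a < r)%N, M + i))%:Z).
  case: ifP => ar; last first.
    by apply: (congr1 determinant); apply/matrixP => i j; rewrite !mxE addn0.
  rewrite -Fdet_succ; apply: (congr1 determinant); apply/matrixP => i j; rewrite !mxE.
  by have ib := ltn_ord i; congr (Posz 'C(_, _)); lia.
rewrite -det_map_mx; apply: (congr1 determinant); apply/matrixP => i j.
by rewrite !mxE /G qa mul1r.
Qed.
End BlockDet.

(** * The product formula for F(M,b) *)

Lemma det_scale (A : comNzRingType) (n : nat) (r c : 'I_n -> A) (P : 'M[A]_n) :
  \det (\matrix_(i < n, j < n) (r i * P i j * c j)) =
  (\prod_(i < n) r i) * \det P * \prod_(i < n) c i.
Proof.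
have -> : \matrix_(i < n, j < n) (r i * P i j * c j) =
    diag_mx (\row_i r i) *m P *m diag_mx (\row_j c j).
  by apply/matrixP => i j; rewrite mul_mx_diag mul_diag_mx !mxE.
by rewrite !det_mulmx !det_diag; congr (_ * _ * _); apply: eq_bigr => i _; rewrite mxE.
Qed.

Lemma bin_ffact_shift (N K x l : nat) : (N + l = K + x)%N ->
  ('C(N, K) * (x`! * K`!) = x ^_ l * N`!)%N.
Proof.
move=> e; have [lx|xl] := leqP l x; last first.
  by rewrite bin_small ?ffact_small //; lia.
have KN : (K <= N)%N by lia.
rewrite -(bin_fact KN) -(ffact_fact lx); have -> : (N - K = x - l)%N by lia.
by nia.
Qed.

Lemma fact_addn (a s : nat) : ((a + s)`! = a`! * \prod_(t < s) (a + t.+1))%N.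
Proof.
elim: s => [|s IH]; first by rewrite addn0 big_ord0 muln1.
by rewrite addnS factS IH big_ord_recr /= addnS; nia.
Qed.

Section ProductFormula.
Variable A : numFieldType.
Implicit Types (M b l : nat).

Lemma natr_ffact x l : (x ^_ l)%:R = \prod_(t < l) (x%:R - t%:R) :> A.
Proof.
elim: l => [|l IH]; first by rewrite big_ord0 ffactn0.
rewrite ffactnSr natrM IH big_ord_recr /=.
have [lx|xl] := leqP l x; first by rewrite natrB.
by rewrite -IH ffact_small // !mul0r.
Qed.

(* Up to rescaling of rows and columns, the binomial in row i and column l (both
   counted backwards) is the value at 2i of this polynomial of degree b - 1. *)
Definition kratt M b l : {poly A} :=
  (\prod_(t < l) ('X - t%:R%:P)) *
  \prod_(t < b.-1 - l) ('X + (2 * M + 2 * t.+1)%N%:R%:P).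

Definition kratt_coef M b : 'M[A]_b := \matrix_(d < b, l < b) (kratt M b l)`_d.

Lemma size_prod_monic (n : nat) (f : 'I_n -> A) :
  \prod_(t < n) ('X + (f t)%:P) \is monic /\ size (\prod_(t < n) ('X + (f t)%:P)) = n.+1.
Proof.
have E : \prod_(t < n) ('X + (f t)%:P) =
  \prod_(a <- [seq - f t | t <- enum 'I_n]) ('X - a%:P).
  by rewrite big_map big_enum /=; apply: eq_bigr => t _; rewrite polyCN opprK.
by rewrite E monic_prod_XsubC size_prod_XsubC size_map size_enum_ord.
Qed.

Lemma size_kratt M b l : (l < b)%N -> size (kratt M b l) = b.
Proof.
move=> lb; have [m1 s1] := size_prod_monic (fun t : 'I_l => - t%:R).
have [m2 s2] := size_prod_monic (fun t : 'I_(b.-1 - l) => (2 * M + 2 * t.+1)%N%:R).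
rewrite /kratt; have -> : \prod_(t < l) ('X - t%:R%:P) =
  \prod_(t < l) ('X + (- t%:R)%:P) :> {poly A}.
  by apply: eq_bigr => t _; rewrite polyCN.
by rewrite size_monicM ?monic_neq0 // s1 s2; lia.
Qed.

(** The two products share all but one factor, and the remaining ones, X + 2M + 2(b - l) and X - l,
    differ by a constant. *)
Lemma krattB M b l : (l < b)%N ->
  kratt M b.+1 l - kratt M b.+1 l.+1 = (2 * M + 2 * b - l)%N%:R *: kratt M b l.
Proof.
move=> lb; rewrite /kratt /=; have e : (b - l = (b.-1 - l).+1)%N by lia.
have e' : (b - l.+1 = b.-1 - l)%N by lia.
rewrite e e' [\prod_(t < (_ - _).+1) _]big_ord_recr [\prod_(t < l.+1) _]big_ord_recr /=.
set P := \prod_(t < l) _; set Q := \prod_(t < _ - _) _.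
have -> : (2 * M + 2 * b - l)%N%:R = (2 * M + 2 * (b.-1 - l).+1)%N%:R + l%:R :> A.
  by rewrite -natrD; congr (_%:R); lia.
rewrite -mul_polyC polyCD; ring.
Qed.

(** Differences of adjacent columns lower the degree by [krattB], so only the last column, a monic
    polynomial, reaches the top row of coefficients. The minor is the smaller matrix with rescaled
    columns. *)
Lemma det_kratt_coef M b :
  \det (kratt_coef M b) = \prod_(c < b) \prod_(l < c) (2 * M + 2 * c - l)%N%:R.
Proof.
elim: b => [|b IH]; first by rewrite big_ord0; apply: det_mx00.
rewrite big_ord_recr /= -IH.
pose U : 'M[A]_b.+1 :=
  \matrix_(l, c) (if l == c then 1 else if l == c.+1 :> nat then - 1 else 0).
have detU : \det U = 1.
  rewrite det_trig; last first.
    apply/is_trig_mxP => i j ij; rewrite mxE -val_eqE /=.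
    by rewrite !ltn_eqF // ltnW.
  by rewrite big1 // => i _; rewrite mxE eqxx.
transitivity (\det (kratt_coef M b.+1 *m U)); first by rewrite det_mulmx detU mulr1.
have KUm d : (kratt_coef M b.+1 *m U) d ord_max = (kratt M b.+1 b)`_d.
  rewrite mxE (bigD1 ord_max) //= big1 ?addr0 => [|l lm].
    by rewrite !mxE eqxx mulr1.
  by rewrite [U _ _]mxE (negPf lm) ltn_eqF ?mulr0.
have KU d (c : 'I_b) : (kratt_coef M b.+1 *m U) d (lift ord_max c) =
    (2 * M + 2 * b - c)%N%:R * (kratt M b c)`_d.
  have cb := ltn_ord c; have lc : bump b c = c by rewrite /bump leqNgt cb.
  have cb' : (c.+1 < b.+1)%N by [].
  rewrite mxE (bigD1 (lift ord_max c)) //= (bigD1 (Ordinal cb')) //=; last first.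
    by rewrite -val_eqE /= lc gtn_eqF.
  rewrite big1 ?addr0 => [|l /andP[l1 l2]]; last first.
    rewrite [U _ _]mxE (negPf l1) /= lc; move: l2; rewrite -val_eqE /= => /negPf ->.
    by rewrite mulr0.
  rewrite ![U _ _]mxE eqxx mulr1 -val_eqE /= lc gtn_eqF // eqxx mulrN1 !mxE /= lc.
  by rewrite -coefB krattB // coefZ.
rewrite (expand_det_row _ ord_max) (bigD1 ord_max) //= big1 ?addr0 => [|c cm]; last first.
  have [c' ->] : exists c' : 'I_b, c = lift ord_max c'.
    by case: (unliftP ord_max c) cm => [c' -> _|->]; [exists c'|rewrite eqxx].
  by rewrite KU /= nth_default ?mulr0 ?mul0r // size_kratt.
rewrite KUm /= {1}/kratt subnn big_ord0 mulr1.
have -> : (\prod_(t < b) ('X - t%:R%:P))`_b = 1 :> A.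
  have [/monicP m1 s1] := size_prod_monic (fun t : 'I_b => - t%:R).
  rewrite (eq_bigr (fun t : 'I_b => 'X + (- t%:R)%:P)) => [|t _]; last by rewrite polyCN.
  by rewrite -[RHS]m1 lead_coefE s1.
rewrite mul1r /cofactor -signr_odd oddD addbb mul1r.
have := @det_scale A b (fun=> 1) (fun c : 'I_b => (2 * M + 2 *
  b - c)%N%:R) (kratt_coef M b).
rewrite big1 // mul1r => <-; apply: (congr1 determinant); apply/matrixP => d c.
by rewrite [LHS]mxE [LHS]mxE KU !mxE mul1r mulrC lift_max.
Qed.

Lemma horner_kratt M b l i : (kratt M b l).[(2 * i)%N%:R] =
  ((2 * i) ^_ l)%:R * (2 ^+ (b.-1 - l) * (\prod_(t < b.-1 - l) (M + i + t.+1))%N%:R).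
Proof.
rewrite /kratt hornerM !horner_prod.
rewrite (eq_bigr (fun t : 'I_l => (2 * i)%N%:R - t%:R)) => [|t _];
  last by rewrite !hornerE.
rewrite -natr_ffact natr_prod; congr (_ * _).
have -> : 2 ^+ (b.-1 - l) = \prod_(t < b.-1 - l) 2 :> A by rewrite prodr_const card_ord.
rewrite -big_split /=; apply: eq_bigr => t _.
by rewrite !hornerE -natrD -natrM; congr (_%:R); lia.
Qed.

(** Evaluating the polynomials at 0, 2, ..., 2(b - 1) is multiplication by a Vandermonde matrix. The
    constant is free of [M] because the row factors (M + i)! and (M + b - 1 - i)! cancel over all
    rows; it can therefore be eliminated by comparison with M = 0. *)
Lemma Fdet_kratt b : exists kappa : A, forall M,
  (Fdet M b)%:~R = kappa * \det (kratt_coef M b).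
Proof.
pose a : 'rV[A]_b := \row_(i < b) (2 * i)%N%:R.
exists ((\prod_(i < b) ((2 * i)`!%:R)^-1) * \det (Vandermonde b a)
         * \prod_(l < b) (2 ^+ (b.-1 - l))^-1) => M.
have -> : (Fdet M b)%:~R = \det (\matrix_(i < b, l < b)
    ((M + i)`!%:R / ((2 * i)`!%:R * (M + (b.-1 - i))`!%:R)
     * ((Vandermonde b a)^T *m kratt_coef M b) i l * (2 ^+ (b.-1 - l))^-1)).
  rewrite /Fdet -det_map_mx -(det_mxsub_same (@rev_ord_inj b)).
  apply: (congr1 determinant); apply/matrixP => i l; rewrite !mxE /=.
  have ib := ltn_ord i; have lb := ltn_ord l.
  have -> : \sum_(d < b) (Vandermonde b a)^T i d * kratt_coef M b d l =
      (kratt M b l).[(2 * i)%N%:R].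
    rewrite (@horner_coef_wide _ b) ?size_kratt //; apply: eq_bigr => d _.
    by rewrite !mxE mulrC.
  rewrite horner_kratt.
  have e : (M + i + (b.-1 - l) + l = M + (b.-1 - i) + 2 * i)%N by lia.
  have := bin_ffact_shift e; rewrite (fact_addn (M + i)).
  set Pr := (\prod_(_ < _) _)%N => E.
  have -> : (M + (b - (b - i.+1).+1) + (b - l.+1) = M + i + (b.-1 - l))%N by lia.
  have -> : (M + (b - i.+1) = M + (b.-1 - i))%N by lia.
  have {}E := congr1 (fun x : nat => x%:R : A) E; rewrite /= !natrM in E.
  have f0 x : x`!%:R != 0 :> A by rewrite pnatr_eq0 -lt0n fact_gt0.
  have t0 : 2 ^+ (b.-1 - l) != 0 :> A by rewrite expf_neq0 // pnatr_eq0.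
  rewrite -pmulrn; apply: (mulIf (mulf_neq0 (f0 (2 * i)%N) (f0 (M + (b.-1 - i))%N))).
  rewrite E; field; by rewrite t0 !f0.
rewrite det_scale det_mulmx det_tr.
have -> : \prod_(i < b) ((M + i)`!%:R / ((2 * i)`!%:R * (M + (b.-1 - i))`!%:R)) =
   \prod_(i < b) ((2 * i)`!%:R)^-1 :> A.
  have f0 x : x`!%:R != 0 :> A by rewrite pnatr_eq0 -lt0n fact_gt0.
  rewrite (eq_bigr (fun i : 'I_b => (((2 * i)`!%:R)^-1 *
    (M + i)`!%:R) / (M + (b.-1 - i))`!%:R)); last first.
    by move=> i _; field; rewrite !f0.
  rewrite big_split big_split /= -mulrA -[RHS]mulr1; congr (_ * _).
  rewrite [X in X * _](reindex_inj rev_ord_inj) /= -big_split /= big1 // => i _.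
  have -> : (b - i.+1 = b.-1 - i)%N by have := ltn_ord i; lia.
  by rewrite mulfV.
by rewrite !mulrA mulrAC.
Qed.

(** For M = 0 this is [det_hz] with staircase exponents and all variables equal to 1. *)
Lemma Fdet0 b : Fdet 0 b = 1.
Proof.
apply: (@intr_inj A); rewrite -det_map_mx.
have p1 : 1.-primitive_root (1 : A).
  by apply/andP; split=> //; apply/forallP => i; rewrite unity_rootE expr1n eqxx (ord1 i).
rewrite [RHS](_ : _ = \prod_(i < b) (1 ^+ i) ^+ (b - i.+1)); last first.
  by rewrite big1 // => i _; rewrite !expr1n.
rewrite -(det_hz (fun i => 1 ^+ i) b (fun i => b - i.+1)%N).
apply: (congr1 determinant); apply/matrixP => i j; rewrite !mxE.
have := @hz_full A 1 1 p1 i ((b - i.+1)%:Z - i%:Z + j%:Z) 0 isT.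
rewrite !mul1n mul1r addr0 => ->; have := @binz_nat 0 b i j 0 (ltn_ord i).
by rewrite addr0 !add0n addn0 => ->; rewrite [RHS]pmulrn.
Qed.

Lemma Fdet_prod M b : (Fdet M b)%:~R =
  \prod_(c < b) \prod_(l < c) (1 + (2 * M)%N%:R / (2 * c - l)%N%:R) :> A.
Proof.
have [kappa FE] := Fdet_kratt b; have := FE 0%N; rewrite Fdet0 => k1.
have d0 : \det (kratt_coef 0 b) != 0.
  by apply/eqP => d0; move/eqP: k1; rewrite d0 mulr0 oner_eq0.
have -> : (Fdet M b)%:~R = \det (kratt_coef M b) / \det (kratt_coef 0 b).
  by apply: (mulIf d0); rewrite FE mulfVK // mulrAC -k1 mul1r.
rewrite !det_kratt_coef -prodf_div; apply: eq_bigr => c _.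
rewrite -prodf_div; apply: eq_bigr => l _; have lc := ltn_ord l.
rewrite muln0 add0n; have c0 : (2 * c - l)%N%:R != 0 :> A by rewrite pnatr_eq0; lia.
by rewrite -addnBA ?natrD ?mulrDl ?divff // 1?addrC //; lia.
Qed.
End ProductFormula.

(** * Asymptotics *)

From mathcomp Require Import all_classical all_reals all_analysis.
From mathcomp Require Import complex.

Import numFieldNormedType.Exports.
Import SchubertTheory.
Local Open Scope classical_set_scope.
Local Open Scope ring_scope.

(** * Logarithms of the product formula under dilation *)

Section LogGrowth.
Variable R : realType.
Implicit Types (M b c d n : nat) (bs : seq nat).

Definition lnh M d : R := ln (1 + (2 * M)%N%:R / d%:R).

Lemma lnh_ge0 M d : 0 <= lnh M d.
Proof. by apply: ln_ge0; rewrite lerDl. Qed.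

Lemma lnh_pos M d : 0 < 1 + (2 * M)%N%:R / d%:R :> R.
Proof. by rewrite ltr_pwDl. Qed.

Lemma le_lnh M d d' : (0 < d)%N -> (d <= d')%N -> lnh M d' <= lnh M d.
Proof.
move=> d0 dd'; rewrite ler_ln ?posrE ?lnh_pos // lerD2l ler_wpM2l //.
by rewrite lef_pV2 ?posrE ?ltr0n ?ler_nat // (leq_trans d0).
Qed.

Lemma lnh_scale c M d : (0 < c)%N -> lnh (c * M) (c * d) = lnh M d.
Proof.
move=> c0; rewrite /lnh mulnCA !natrM invfM [in LHS]mulrACA divff ?mul1r //.
by rewrite pnatr_eq0 -lt0n.
Qed.

Lemma lnh_le M d : lnh M d <= (2 * M)%N%:R / d%:R.
Proof. by apply: le_ln1Dx; apply: lt_le_trans (_ : 0 <= _);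
  rewrite ?ltrN10 ?divr_ge0. Qed.

(** The inner index of the product formula is reversed, so that the denominators increase from beta
    + 1 to 2 beta. *)
Definition lnF M b : R := \sum_(beta < b) \sum_(l < beta) lnh M (beta + l.+1).

Lemma Fdet_ge1 M b : 1 <= (Fdet M b)%:~R :> R.
Proof.
rewrite Fdet_prod; elim/big_ind: _ => // [x y x1 y1|c _]; first by rewrite mulr_ege1.
by elim/big_ind: _ => // [x y x1 y1|l _]; [rewrite mulr_ege1|rewrite lerDl].
Qed.

Lemma ln_prod (I : Type) (r : seq I) (f : I -> R) : (forall i, 0 < f i) ->
  ln (\prod_(i <- r) f i) = \sum_(i <- r) ln (f i).
Proof.
move=> f0; suff [_] : 0 < \prod_(i <- r) f i /\ ln (\prod_(i <- r) f i) =
  \sum_(i <- r) ln (f i) by [].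
elim: r => [|i r [IH1 IH2]]; first by rewrite !big_nil ln1.
by rewrite !big_cons mulr_gt0 // lnM ?posrE // IH2.
Qed.

Lemma ln_Fdet M b : ln (Fdet M b)%:~R = lnF M b.
Proof.
rewrite Fdet_prod ln_prod => [|c]; last by apply: prodr_gt0 => l _; apply: lnh_pos.
apply: eq_bigr => c _; rewrite ln_prod => [|l]; last exact: lnh_pos.
rewrite (reindex_inj rev_ord_inj) /=; apply: eq_bigr => l _.
by rewrite -/(lnh _ _); congr lnh; have := ltn_ord l; lia.
Qed.

Lemma lnF1 M : lnF M 1 = 0.
Proof. by rewrite /lnF big_ord1 big_ord0. Qed.

Lemma lnFS M b : lnF M b <= lnF M b.+1.
Proof. by rewrite [leRHS]big_ord_recr lerDl sumr_ge0 // => l _; apply: lnh_ge0. Qed.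

(** Each inner sum has beta terms of size at most 2M / beta. *)
Lemma lnF_le M b : lnF M b <= (2 * M * b)%N%:R.
Proof.
rewrite /lnF natrM mulr_natr -[b in leRHS]card_ord -sumr_const; apply: ler_sum => c _.
have [->|c0] := eqVneq (c : nat) 0%N; first by rewrite big_ord0.
apply: (@le_trans _ _ (\sum_(l < c) ((2 * M)%N%:R / c%:R))).
  apply: ler_sum => l _; apply: le_trans (lnh_le _ _) _; rewrite ler_wpM2l //.
  by rewrite lef_pV2 ?posrE ?ltr0n ?ler_nat ?leq_addr ?lt0n ?addn_eq0 ?negb_and ?c0.
by rewrite sumr_const card_ord -[_ / _ *+ _]mulr_natr divfK // pnatr_eq0.
Qed.

Lemma sum_ord_mul c b (f : nat -> R) :
  \sum_(i < c * b) f i = \sum_(j < b) \sum_(a < c) f (c * j + a)%N.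
Proof.
elim: b => [|b IH]; first by rewrite muln0 !big_ord0.
rewrite mulnS addnC big_split_ord /= IH [RHS]big_ord_recr /=; congr (_ + _).
Qed.

(** The dilated indices are grouped as c beta + a and c l + a', with a, a' < c, and the surplus
    terms, which are nonnegative, are dropped. Passing from l + 1 to l + 2 in [s] makes room for
    both remainders; it costs a telescoping sum, at most ln(1 + 2M) for each beta. *)
Lemma lnF_scale c M b : (0 < c)%N ->
  (c ^ 2)%N%:R * (lnF M b - b%:R * ln (1 + (2 * M)%N%:R)) <= lnF (c * M) (c * b).
Proof.
move=> c0; pose s := \sum_(beta < b) \sum_(l < beta) lnh M (beta + l.+2).
apply: (@le_trans _ _ ((c ^ 2)%N%:R * s)).
  rewrite ler_wpM2l // lerBlDr mulr_natl -[b in _ *+ b]card_ord -sumr_const -big_split /=.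
  apply: ler_sum => be _; rewrite -lerBlDl -sumrB.
  have -> : \sum_(l < be) (lnh M (be + l.+1) - lnh M (be + l.+2)) =
      lnh M be.+1 - lnh M (be + be.+1).
    rewrite -(big_mkord xpredT (fun l => lnh M (be + l.+1) - lnh M (be + l.+2))).
    rewrite (telescope_sumr_eq (fun l => - lnh M (be + l.+1))) //.
      by rewrite opprK addrC addn1.
    by move=> l _; rewrite opprK addrC.
  apply: (@le_trans _ _ (lnh M be.+1)); first by rewrite gerBl lnh_ge0.
  by apply: le_trans (le_lnh M _ (ltn0Sn be)) _; rewrite // /lnh divr1.
rewrite /s mulr_sumr /lnF (sum_ord_mul c b (fun be => \sum_(l < be) lnh (c *
  M) (be + l.+1))); apply: ler_sum => be _.
apply: (@le_trans _ _ (\sum_(a < c) \sum_(l < c * be) lnh (c * M) (c *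
  be + a + l.+1))); last first.
  apply: ler_sum => a _; rewrite big_split_ord /= lerDl.
  by apply: sumr_ge0 => l _; apply: lnh_ge0.
apply: (@le_trans _ _ (\sum_(a < c) \sum_(l < be) \sum_(a' < c) lnh (c * M) (c *
  (be + l.+2)))).
  rewrite [leRHS](eq_bigr (fun=> c%:R * \sum_(l < be) lnh M (be + l.+2))) => [|a _].
    by rewrite sumr_const card_ord -[(_ * _) *+ _]mulr_natl mulrA -natrM mulnn.
  rewrite mulr_sumr; apply: eq_bigr => l _.
  by rewrite sumr_const card_ord -[lnh _ _ *+ _]mulr_natl lnh_scale.
apply: ler_sum => a _;
  rewrite (sum_ord_mul c be (fun l => lnh (c * M) (c * be + a + l.+1))).
(* As a + a' + 1 < 2c, the denominator c beta + a + c l + a' + 1 is at most c(beta + l + 2). *)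
apply: ler_sum => l _; apply: ler_sum => a' _; apply: le_lnh; first by rewrite addnS.
by have := ltn_ord a; have := ltn_ord a'; rewrite mulnDr !mulnS; lia.
Qed.

Fixpoint lnG M bs : R := if bs is b :: bs' then lnF M b + lnG (M + b) bs' else 0.

Lemma lnG_rcons M bs b : lnG M (rcons bs b) = lnG M bs + lnF (M + sumn bs) b.
Proof.
elim: bs M => [|b' bs IH] M /=; first by rewrite addr0 add0r addn0.
by rewrite IH addrA addnA.
Qed.

Lemma lnG_le M bs n : (M + sumn bs <= n)%N -> lnG M bs <= (2 * n * sumn bs)%N%:R.
Proof.
elim: bs M => [|b bs IH] M /=; first by rewrite muln0.
rewrite addnA => Mn; rewrite mulnDr natrD; apply: lerD; last exact: IH.
by apply: le_trans (lnF_le _ _) _; rewrite ler_nat leq_mul2r leq_mul2l; lia.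
Qed.

Lemma lnG_scale c M bs n : (0 < c)%N -> (M + sumn bs <= n)%N ->
  (c ^ 2)%N%:R * (lnG M bs - (sumn bs)%:R * ln (1 + (2 * n)%N%:R)) <=
  lnG (c * M) [seq (c * b)%N | b <- bs].
Proof.
move=> c0; elim: bs M => [|b bs IH] M /=; first by rewrite mul0r subr0 mulr0.
rewrite addnA => Mn; have := IH _ Mn; rewrite mulnDr => {}IH.
apply: le_trans (lerD (lnF_scale M b c0) IH); rewrite -mulrDr ler_wpM2l //.
rewrite natrD mulrDl opprD addrACA lerD2r lerD2l lerN2 ler_wpM2l //.
by rewrite ler_ln ?posrE ?ltr_pwDl // lerD2l ler_nat leq_mul2l; lia.
Qed.
End LogGrowth.

Fixpoint prodFdet (M : nat) (bs : seq nat) : int :=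
  if bs is b :: bs' then Fdet M b * prodFdet (M + b) bs' else 1.

(** A block without remainder contributes F^k, shared as F^(k-r) F^r between the two products, which
    differ only in their last block. *)
Lemma multi_layered_detE (A : fieldType) (k : nat) (q : A) (b r M : nat) (bs : seq nat) :
  k.-primitive_root q -> (r < k)%N -> exists e : bool,
  (r = 0%N -> e = false) /\
  multi_layered_det (fun i => q ^+ i) k b r (k * M) bs =
  (-1) ^+ e * ((prodFdet M (rcons bs b)) ^+ (k - r) *
    (prodFdet M (rcons bs b.+1)) ^+ r)%:~R.
Proof.
move=> qP rk; elim: bs M => [|b' bs IH] M /=.
  by have [e [e0 E]] := block_detE qP M b rk; exists e; rewrite !mulr1.
have k0 : (0 < k)%N by lia.
have [e [e0 E]] := block_detE qP M b' k0; have [e' [e'0 E']] := IH (M + b')%N.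
exists e'; split=> //; rewrite -mulnDr E E' (e0 erefl) mul1r subn0 expr0 mulr1.
rewrite mulrCA -rmorphM /= !exprMn mulrACA -exprD subnK //; exact: ltnW.
Qed.

(** * The maxima as products of the numbers F(M,b) *)

Section Values.
Variable R : realType.
Implicit Types (k n b r : nat) (bs : seq nat) (j : int).

Lemma prodFdet_ge1 M bs : 1 <= (prodFdet M bs)%:~R :> R.
Proof.
elim: bs M => [|b bs IH] M //=.
by rewrite rmorphM /= mulr_ege1 // Fdet_ge1.
Qed.

Lemma ln_prodFdet M bs : ln ((prodFdet M bs)%:~R : R) = lnG R M bs.
Proof.
elim: bs M => [|b bs IH] M /=; first by rewrite ln1.
by rewrite rmorphM /= lnM ?IH ?ln_Fdet // posrE (lt_le_trans ltr01) // (Fdet_ge1,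
  prodFdet_ge1).
Qed.

Lemma bigmax_attained (I : finType) (P : pred I) (F : I -> R) i0 :
  P i0 -> 0 < F i0 -> exists2 i, P i & \big[Num.max/0]_(i | P i) F i = F i.
Proof.
move=> Pi0 F0.
have : \big[Num.max/0]_(i | P i) F i =
  0 \/ exists2 i, P i & \big[Num.max/0]_(i | P i) F i = F i.
  elim/big_ind: _ => [|x y xE yE|i Pi]; [by left| |by right; exists i].
  by rewrite /Num.max; case: ifP.
case=> // E; have : F i0 <= \big[Num.max/0]_(i | P i) F i by apply: le_bigmax_cond.
by rewrite E leNgt F0.
Qed.

Lemma schubert_eval1_layered n bs b (w : 'S_n) : n = (sumn bs + b)%N ->
  oneline w = foldr direct_prod [::] [seq w0 b | b <- rcons bs b] ->
  Schubert.schubert_eval (fun=> 1 : R) w = (prodFdet 0 (rcons bs b))%:~R.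
Proof.
move=> nE; rewrite map_rcons foldr_rcons /direct_prod /= cats0 -/direct_prod => wE.
have p1 : 1.-primitive_root (1 : R).
  by apply/andP; split=> //; apply/forallP => i; rewrite unity_rootE expr1n eqxx (ord1 i).
have -> : (fun=> 1 : R) = (fun i => 1 ^+ i) by apply/funext => i; rewrite expr1n.
rewrite (@schubert_eval_multi_layered _ _ 1 b 0 n bs) //.
- have [e [e0]] := @multi_layered_detE _ 1 _ b 0 0 bs p1 isT.
  by rewrite (e0 erefl) muln0 => ->; rewrite mul1r expr0 mulr1 expr1.
- by rewrite nE; lia.
- by rewrite wE mul1n addn0 -w0E; congr foldr; apply: eq_map => b'; rewrite mul1n w0E.
Qed.

Lemma layered_onto n bs b : n = (sumn bs + b)%N -> exists w : 'S_n,
  oneline w = foldr direct_prod [::] [seq w0 b | b <- rcons bs b].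
Proof.
move=> nE; have [||w wE] := @multi_layered_onto 1 b 0 n bs; [by []|by lia|].
exists w; rewrite wE map_rcons foldr_rcons /direct_prod /= cats0 -/direct_prod.
by rewrite mul1n addn0 -w0E; congr foldr; apply: eq_map => b'; rewrite mul1n w0E.
Qed.

Lemma v_ge n bs : (0 < n)%N -> all (fun b => 0 < b)%N bs -> sumn bs = n ->
  (prodFdet 0 bs)%:~R <= v R n.
Proof.
move=> n0; case: (lastP bs) => [_ /= n1|{}bs b bP bn]; first by rewrite -n1 in n0.
have nE : n = (sumn bs + b)%N by rewrite -bn sumn_rcons.
have [w wE] := layered_onto nE; rewrite -(schubert_eval1_layered nE wE).
by apply: le_bigmax_cond; apply/asboolP; exists (rcons bs b).
Qed.

Lemma v_eq n : (0 < n)%N -> exists bs,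
  [/\ all (fun b => 0 < b)%N bs, sumn bs = n & v R n = (prodFdet 0 bs)%:~R].
Proof.
move=> n0; have nE : n = (sumn [::] + n)%N by [].
have [w wE] := layered_onto nE.
have wL : `[< layered w >] by apply/asboolP; exists [:: n]; rewrite /= n0 addn0.
have w0 : 0 < Schubert.schubert_eval (fun=> 1 : R) w.
  by rewrite (schubert_eval1_layered nE wE) (lt_le_trans ltr01) // prodFdet_ge1.
have [u /asboolP[bs [bP bn uE]]] :=
  @bigmax_attained _ (fun u : 'S_n => `[< layered u >]) (fun u =>
    Schubert.schubert_eval (fun=> 1 : R) u) _ wL w0.
rewrite -/(v R n) => ->; exists bs; split=> //.
case: (lastP bs) bP bn uE => [_ /= n1|{}bs b bP bn uE]; first by rewrite -n1 in n0.
by apply: schubert_eval1_layered uE; rewrite -bn sumn_rcons.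
Qed.

Lemma normc_sign_int (e : bool) (z : int) : 0 <= z ->
  Normc.normc ((-1) ^+ e * z%:~R : R[i]) = z%:~R.
Proof.
case: z => // m _; rewrite Normc.normcM.
have -> : Normc.normc ((-1) ^+ e : R[i]) = 1.
  by case: e; rewrite ?expr1 ?expr0 ?normcN Normc.normc1.
by rewrite mul1r -pmulrn normcMn Normc.normc1 pmulrn.
Qed.

Variables (k : nat) (j : int).
Hypothesis zP : k.-primitive_root (zeta R k j).
Let k0 : (0 < k)%N. Proof. exact: prim_order_gt0 zP. Qed.

Lemma Phi_multi_layered n bs b r (w : 'S_n) : (r < k)%N -> n =
  (k * (sumn bs + b) + r)%N ->
  oneline w = foldr direct_prod (w0k k (k * b + r)) [seq w0k k (k * b') | b' <- bs] ->
  Phi R k j w = (prodFdet 0 (rcons bs b))%:~R ^+ (k - r)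
              * (prodFdet 0 (rcons bs b.+1))%:~R ^+ r.
Proof.
move=> rk nE wE; rewrite /Phi (schubert_eval_multi_layered _ rk nE wE).
have [e [_]] := @multi_layered_detE _ k _ b r 0 bs zP rk; rewrite muln0 => ->.
rewrite normc_sign_int ?rmorphM ?rmorphXn //.
have ge0 M s : 0 <= prodFdet M s.
  by rewrite -(ler0z R); apply: le_trans ler01 (prodFdet_ge1 _ _).
by rewrite mulr_ge0 ?exprn_ge0.
Qed.

Lemma vk_ge n bs b r : (r < k)%N -> n = (k * (sumn bs + b) + r)%N ->
  all (fun b => 0 < b)%N bs -> (0 < b)%N ->
  (prodFdet 0 (rcons bs b))%:~R ^+ (k - r) * (prodFdet 0 (rcons bs b.+1))%:~R ^+ r
  <= vk R k j n.
Proof.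
move=> rk nE bsP b0; have [w wE] := multi_layered_onto rk nE.
rewrite -(Phi_multi_layered rk nE wE).
have nk : (n %% k = r)%N by rewrite nE mulnC modnMDl modn_small.
by apply: le_bigmax_cond; apply/asboolP; exists bs, b; rewrite nk.
Qed.

Lemma vk_eq n : (k <= n)%N -> exists bs b,
  [/\ all (fun b => 0 < b)%N bs, (0 < b)%N, n = (k * (sumn bs + b) + n %% k)%N &
   vk R k j n = (prodFdet 0 (rcons bs b))%:~R ^+ (k - n %% k)
     * (prodFdet 0 (rcons bs b.+1))%:~R ^+ (n %% k)].
Proof.
move=> kn; have rk : (n %% k < k)%N by rewrite ltn_pmod.
have nE : n = (k * (sumn [::] + n %/ k) + n %% k)%N by rewrite mulnC; apply: divn_eq.
have b0 : (0 < n %/ k)%N by rewrite divn_gt0.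
have [w wE] := multi_layered_onto rk nE.
have wL : `[< multi_layered k w >] by apply/asboolP; exists [::], (n %/ k)%N.
have w0 : 0 < Phi R k j w.
  by rewrite (Phi_multi_layered rk nE wE) mulr_gt0 // exprn_gt0 // (lt_le_trans ltr01)
    // prodFdet_ge1.
have [u /asboolP[bs [b [bP bb bn uE]]]] :=
  @bigmax_attained _ (fun u : 'S_n => `[< multi_layered k u >]) (fun u => Phi R k j u)
    _ wL w0.
by rewrite -/(vk R k j n) => ->; exists bs, b; split;
  rewrite // -(Phi_multi_layered rk bn uE).
Qed.

End Values.

(** * Primitivity of the root of unity *)

Section Zeta.
Variable R : realType.
Implicit Types (s t : R).

Let cis t : R[i] := (cos t +i* sin t)%C.

Let cisD s t : cis (s + t) = cis s * cis t.
Proof. by apply/eqP; rewrite eq_complex /= cosD sinD [_ + cos s * _]addrC !eqxx. Qed.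

Let cis0 : cis 0 = 1.
Proof. by rewrite /cis cos0 sin0. Qed.

Let cisMn t n : cis (t *+ n) = cis t ^+ n.
Proof. by elim: n => [|n IH]; rewrite ?cis0 // mulrS exprS cisD IH. Qed.

Let cis2pi (z : int) : cis (2 * pi * z%:~R) = 1.
Proof.
have nat1 (n : nat) : cis (2 * pi * n%:R) = 1.
  have cis2 : cis (2 * pi) = 1 by rewrite mulr_natl /cis cos2pi sin2pi.
  by rewrite mulr_natr cisMn cis2 expr1n.
case: z => n; first exact: nat1.
have := cisD (2 * pi * n.+1%:R) (- (2 * pi * n.+1%:R)).
by rewrite subrr cis0 nat1 mul1r NegzE mulrNz -pmulrn mulrN => <-.
Qed.

(** For 0 < m < k, coprimality makes the residue s of jm mod k nonzero, so the m-th power has real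
    part 1 - 2 sin(pi s / k)^2 < 1. *)
Lemma zeta_primitive k (j : int) : (0 < k)%N -> coprimez j k%:Z ->
  k.-primitive_root (zeta R k j).
Proof.
move=> k0 jk; rewrite /primitive_root_of_unity k0 /=; apply/forallP => i.
have kN0 : k%:R != 0 :> R by rewrite pnatr_eq0 -lt0n.
rewrite unity_rootE -[zeta _ _ _]/(cis _) -cisMn; apply/eqP.
have [->|ik] := eqVneq i.+1 k.
  by rewrite -[_ / _ *+ _]mulr_natr divfK // cis2pi eqxx.
have ltik : (i.+1 < k)%N by rewrite ltn_neqAle ik ltn_ord.
set m := i.+1 in ik ltik *; pose s := ((j * m%:Z) %% k%:Z)%Z.
have kz : k%:Z != 0 by lia.
have s0 : 0 <= s by apply: modz_ge0.
have sk : s < k%:Z by apply: ltz_pmod; lia.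
have sN0 : s != 0.
  apply: contraTneq ltik => s0'; rewrite -leqNgt.
  have : (k%:Z %| j * m%:Z)%Z by apply/dvdz_mod0P.
  rewrite Gauss_dvdzr; last by rewrite coprimez_sym.
  by rewrite /dvdz /= => /dvdn_leq; apply.
have -> : 2 * pi * j%:~R / k%:R *+ m =
  2 * pi * ((j * m%:Z) %/ k%:Z)%Z%:~R + (pi * s%:~R / k%:R) *+ 2 :> R.
  rewrite -[_ / _ *+ m]mulr_natr; have := divz_eq (j * m%:Z) k%:Z;
    rewrite -/s => /(congr1 (fun z : int => z%:~R : R)).
  rewrite rmorphD !rmorphM /= -!pmulrn => E.
  have -> : 2 * pi * j%:~R / k%:R * m%:R =
    2 * pi * (j%:~R * m%:R) / k%:R :> R by rewrite mulrAC -!mulrA.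
  by rewrite E mulrDr mulrDl mulrA mulfK // -[in RHS]mulr_natr; congr (_ + _); ring.
rewrite cisD cis2pi mul1r; apply/negbTE; rewrite eq_complex /= negb_and; apply/orP; left.
have s0R : 0 < s%:~R :> R by rewrite ltr0z lt_def sN0 s0.
have skR : s%:~R < k%:R :> R by rewrite pmulrn ltr_int.
have sp : 0 < sin (pi * s%:~R / k%:R) :> R.
  apply: sin_gt0_pi; rewrite divr_gt0 ?mulr_gt0 ?pi_gt0 ?ltr0n //=.
  by rewrite ltr_pdivrMr ?ltr0n // ltr_pM2l // pi_gt0.
by rewrite cos_mulr2n cos2sin2 lt_eqF //; nra.
Qed.
End Zeta.

(** * Convergence from dilation with a subquadratic error *)

Section SubquadraticError.
Variable R : realType.

(** With t^2 = 1 + 2n <= 3n, the logarithm is 2 ln t <= 2t, and (2t)^2 <= 12n; hence the constant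
    12. *)
Lemma ln_linear_small (eps : R) (n : nat) : 0 < eps -> 12 / eps ^+ 2 <= n%:R ->
  ln (1 + (2 * n)%N%:R) / n%:R <= eps.
Proof.
move=> e0 le; have n0 : 0 < n%:R :> R by apply: lt_le_trans le;
  rewrite divr_gt0 // exprn_gt0.
have n1 : 1 <= n%:R :> R by rewrite ler1n -(ltr0n R).
rewrite ler_pdivrMr // natrM; pose t := Num.sqrt (1 + 2 * n%:R : R).
have t2 : t ^+ 2 = 1 + 2 * n%:R by rewrite sqr_sqrtr //; lra.
have t0 : 0 < t by rewrite sqrtr_gt0; lra.
rewrite -t2 lnXn // -mulr_natr.
have lt := ln_sublinear t0; apply: (@le_trans _ _ (2 * t)); first by lra.
have {le} : 12 <= eps ^+ 2 * n%:R by rewrite mulrC -ler_pdivrMr // exprn_gt0.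
move=> le; rewrite -(@ler_pXn2r _ 2) ?nnegrE //; nra.
Qed.

(** The limit is the supremum of the corrected ratios [s n]: the correction [e n] tends to 0, and
    dilation together with monotonicity carries a nearly maximal [s n] to all large N. *)
Lemma growth_cvg (x : nat -> R) :
  (forall m n, (0 < m)%N -> (m <= n)%N -> x m <= x n) ->
  (forall n, (0 < n)%N -> x n <= 2 * n%:R ^+ 2) ->
  (forall c n, (0 < c)%N -> (0 < n)%N ->
     c%:R ^+ 2 * (x n - n%:R * ln (1 + (2 * n)%N%:R)) <= x (c * n)%N) ->
  cvgn (fun n => x n / n%:R ^+ 2).
Proof.
move=> mono bnd scale; pose e n : R := ln (1 + (2 * n)%N%:R) / n%:R.
pose s n := x n / n%:R ^+ 2 - e n.
have e0 n : 0 <= e n by rewrite divr_ge0 // ln_ge0 // lerDl.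
have s2 n : (0 < n)%N -> s n <= 2.
  move=> n0; rewrite lerBlDr; apply: (@le_trans _ _ 2); last by rewrite lerDl.
  by rewrite ler_pdivrMr ?exprn_gt0 ?ltr0n // bnd.
pose S := [set s n | n in [set n | (0 < n)%N]].
have supS : has_sup S.
  by split; [exists (s 1%N); exists 1%N|exists 2 => _ [n /= n0 <-]; apply: s2].
apply/cvg_ex; exists (sup S); apply/cvgrPdist_le => /= eps eps0;
  have eps2 : 0 < eps / 2 by rewrite divr_gt0.
have [_ [n /= n0 <-] sn] := sup_adherent eps2 supS.
near=> N.
have nN : (n <= N)%N by near: N; exact: nbhs_infty_ge.
have N0 : (0 < N)%N by apply: leq_trans nN.
have NR0 : 0 < N%:R :> R by rewrite ltr0n.
have eN : e N <= eps.
  by apply: ln_linear_small => //; near: N; exact: nbhs_infty_ger.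
have large : 8 * n%:R / eps <= N%:R by near: N; exact: nbhs_infty_ger.
have up : x N / N%:R ^+ 2 <= sup S + eps.
  have : s N <= sup S by apply: sup_upper_bound => //; exists N.
  by rewrite /s; lra.
(* With cn the largest multiple of n up to N, N^2 - (cn)^2 <= 2nN; the bound s n <= 2 turns this
   into the constant 4. *)
have lo : s n - 4 * n%:R / N%:R <= x N / N%:R ^+ 2.
  rewrite ler_pdivlMr ?exprn_gt0 //.
  pose c := (N %/ n)%N; have c0 : (0 < c)%N by rewrite divn_gt0.
  have cN : (c * n <= N)%N by apply: leq_trunc_div.
  have Nc : (N <= c * n + n)%N by rewrite {1}(divn_eq N n) leq_add2l ltnW // ltn_pmod.
  have xc := le_trans (scale c n c0 n0) (mono _ _ (_ : 0 < c * n)%N cN).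
  have {xc} xc : (c * n)%N%:R ^+ 2 * s n <= x N.
    apply: le_trans (xc _); last by rewrite muln_gt0 c0.
    have nR : n%:R != 0 :> R by rewrite pnatr_eq0 -lt0n.
    by rewrite /s /e natrM le_eqVlt; apply/orP; left; apply/eqP; field.
  apply: le_trans xc; have := s2 n n0.
  have {cN} : (c * n)%N%:R <= N%:R :> R by rewrite ler_nat.
  have {Nc} : N%:R <= (c * n)%N%:R + n%:R :> R by rewrite -natrD ler_nat.
  have : 0 <= (c * n)%N%:R :> R by [].
  have -> : (s n - 4 * n%:R / N%:R) * N%:R ^+ 2 = s n * N%:R ^+ 2 - 4 * n%:R * N%:R.
    by field; rewrite gt_eqF.
  have : 0 <= n%:R :> R by [].
  move: (s n) (c * n)%N%:R (N%:R : R) (n%:R : R) => t m p q q0 m0 pm mp t2.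
  have h1 : 0 <= (2 - t) * (p ^+ 2 - m ^+ 2).
    by rewrite mulr_ge0 ?subr_ge0 // ler_pXn2r ?nnegrE //; lra.
  have h2 : 0 <= (m + q - p) * p by rewrite mulr_ge0; lra.
  have h3 : 0 <= (m + q - p) * m by rewrite mulr_ge0; lra.
  have h4 : 0 <= q * (p - m) by rewrite mulr_ge0; lra.
  by nra.
have l4 : 4 * n%:R / N%:R <= eps / 2.
  by move: large; rewrite !ler_pdivrMr // => large; rewrite mulrAC ler_pdivlMr //; lra.
by rewrite ler_norml; lra.
Unshelve. all: by end_near. Qed.
End SubquadraticError.

(** * Comparison of the two maxima and the limits *)

Section LogValues.
Variable R : realType.
Implicit Types (n k : nat).

Lemma ln_v_ge n bs : (0 < n)%N -> all (fun b => 0 < b)%N bs -> sumn bs = n ->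
  lnG R 0 bs <= ln (v R n).
Proof.
move=> n0 bsP bn; have P := v_ge R n0 bsP bn; rewrite -ln_prodFdet.
have p0 : 0 < (prodFdet 0 bs)%:~R :> R by apply: lt_le_trans ltr01 (prodFdet_ge1 _ _ _).
by rewrite ler_ln ?posrE // (lt_le_trans p0).
Qed.

Lemma ln_v_eq n : (0 < n)%N -> exists bs,
  [/\ all (fun b => 0 < b)%N bs, sumn bs = n & ln (v R n) = lnG R 0 bs].
Proof.
by move=> /(v_eq R)[bs [bsP bn ->]]; exists bs; rewrite ln_prodFdet.
Qed.

(** Appending a block of size 1 leaves the value unchanged, since F(M,1) = 1. *)
Lemma ln_v_mono m n : (0 < m)%N -> (m <= n)%N -> ln (v R m) <= ln (v R n).
Proof.
move=> m0; elim: n => [|n IH] mn; first by lia.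
move: mn; rewrite leq_eqVlt => /orP[/eqP -> //|mn]; apply: le_trans (IH mn) _.
have n0 : (0 < n)%N by lia.
have [bs [bsP bn ->]] := ln_v_eq n0.
apply: le_trans (_ : lnG R 0 (rcons bs 1) <= _).
  by rewrite lnG_rcons lnF1 addr0.
by apply: ln_v_ge; rewrite ?all_rcons //= sumn_rcons bn addn1.
Qed.

Lemma ln_v_le n : (0 < n)%N -> ln (v R n) <= 2 * n%:R ^+ 2.
Proof.
move=> /ln_v_eq[bs [_ bn ->]]; apply: le_trans (@lnG_le R 0 bs n _) _.
  by rewrite add0n bn.
by rewrite bn !natrM expr2 mulrA.
Qed.

Lemma ln_v_scale c n : (0 < c)%N -> (0 < n)%N ->
  c%:R ^+ 2 * (ln (v R n) - n%:R * ln (1 + (2 * n)%N%:R)) <= ln (v R (c * n)).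
Proof.
move=> c0 n0; have [bs [bsP bn ->]] := ln_v_eq n0.
have le : (0 + sumn bs <= n)%N by rewrite bn.
have := @lnG_scale R c 0 bs n c0 le; rewrite bn muln0 natrX => /le_trans; apply.
apply: ln_v_ge; first by rewrite muln_gt0 c0.
  rewrite all_map; apply: sub_all bsP => b /= b0; by rewrite muln_gt0 c0.
by rewrite -bn; elim: (bs) => [|b bs' /= ->] /=; rewrite ?muln0 // mulnDr.
Qed.

Lemma cvg_ln_v : cvgn (fun n => ln (v R n) / n%:R ^+ 2).
Proof.
by apply: growth_cvg; [exact: ln_v_mono|exact: ln_v_le|exact: ln_v_scale].
Qed.

(** The same block sizes describe both kinds of permutations. Below, an optimal layered choice is
    used with F(M,b) <= F(M,b+1); above, enlarging the last block by one gives a layered permutation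
    of size N + 1, where N = n %/ k. *)
Lemma ln_vk_bounds k (j : int) n : k.-primitive_root (zeta R k j) -> (k <= n)%N ->
  k%:R * ln (v R (n %/ k)) <= ln (vk R k j n) <= k%:R * ln (v R (n %/ k).+1).
Proof.
move=> zP kn; have k0 : (0 < k)%N := prim_order_gt0 zP.
have N0 : (0 < n %/ k)%N by rewrite divn_gt0.
have rk : (n %% k < k)%N by rewrite ltn_pmod.
set r := (n %% k)%N in rk *.
have p0 bs : 0 < (prodFdet 0 bs)%:~R :> R by apply: lt_le_trans ltr01 (prodFdet_ge1 _ _
  _).
have lnE bs b : ln ((prodFdet 0 (rcons bs b))%:~R ^+ (k - r) *
  (prodFdet 0 (rcons bs b.+1))%:~R ^+ r)
   = (k - r)%:R * lnG R 0 (rcons bs b) + r%:R * lnG R 0 (rcons bs b.+1).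
  by rewrite lnM ?posrE ?exprn_gt0 // !lnXn // !ln_prodFdet !mulr_natl.
have kE (a : R) : k%:R * a = (k - r)%:R * a + r%:R * a.
  by rewrite -mulrDl -natrD subnK // ltnW.
apply/andP; split.
  have [bs [bsP bn ->]] := ln_v_eq N0.
  case: (lastP bs) bsP bn => [_ /= n1|{}bs b]; first by rewrite -n1 in N0.
  rewrite all_rcons sumn_rcons => /andP[b0 bsP] bn.
  have nE : n = (k * (sumn bs + b) + r)%N by rewrite bn mulnC; apply: divn_eq.
  have le := vk_ge zP rk nE bsP b0.
  have q0 : 0 < (prodFdet 0 (rcons bs b))%:~R ^+ (k - r) *
    (prodFdet 0 (rcons bs b.+1))%:~R ^+ r :> R.
    by rewrite mulr_gt0 ?exprn_gt0.
  have lnle := le; rewrite -ler_ln ?posrE // in lnle; last exact: lt_le_trans le.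
  apply: le_trans lnle; rewrite lnE kE lerD2l ler_wpM2l // !lnG_rcons lerD2l.
  exact: lnFS.
have [bs [b [bsP b0 nE ->]]] := vk_eq zP kn; rewrite lnE kE.
have bn : (sumn bs + b = n %/ k)%N.
  by rewrite nE mulnC divnMDl // divn_small ?addn0.
apply: lerD; rewrite ler_wpM2l //; last first.
  by apply: ln_v_ge; rewrite ?all_rcons //= sumn_rcons addnS bn.
apply: le_trans (ln_v_mono N0 (leqnSn _)).
by apply: ln_v_ge; rewrite ?all_rcons ?b0 // sumn_rcons bn.
Qed.

Lemma cvg_divn_ratio k (c : nat) : (0 < k)%N -> (c <= 1)%N ->
  (fun n => (n %/ k + c)%N%:R / n%:R) @ \oo --> (k%:R^-1 : R).
Proof.
move=> k0 c1; have kR : 0 < k%:R :> R by rewrite ltr0n.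
have k1 : 1 <= k%:R :> R by rewrite ler1n.
apply/cvgrPdist_le => /= eps eps0; near=> n.
have n1 : eps^-1 <= n%:R by near: n; exact: nbhs_infty_ger.
have n0 : 0 < n%:R :> R by apply: lt_le_trans n1; rewrite invr_gt0.
have lo : (k * (n %/ k) <= n)%N by rewrite mulnC leq_trunc_div.
have up : (n <= k * (n %/ k) + k)%N by rewrite {1}(divn_eq n k) mulnC leq_add2l ltnW //
  ltn_pmod.
have {}lo : k%:R * (n %/ k)%:R <= n%:R :> R by rewrite -natrM ler_nat.
have {}up : n%:R <= k%:R * (n %/ k)%:R + k%:R :> R by rewrite -natrM -natrD ler_nat.
have cR0 : 0 <= c%:R :> R by [].
have cR1 : c%:R <= 1 :> R by rewrite lern1.
have -> : k%:R^-1 - (n %/ k + c)%N%:R / n%:R =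
   (n%:R - k%:R * (n %/ k)%:R - k%:R * c%:R) / (k%:R * n%:R) :> R.
  by rewrite natrD; field; rewrite !gt_eqF.
rewrite normrM normfV [`|k%:R * _|]gtr0_norm ?mulr_gt0 // ler_pdivrMr ?mulr_gt0 //.
have e1 : 1 <= eps * n%:R by rewrite mulrC -ler_pdivrMr // mul1r.
apply: (@le_trans _ _ k%:R); last by rewrite mulrCA ler_peMr // ltW.
have kc : k%:R * c%:R <= k%:R :> R by rewrite ler_piMr // ltW.
have kc0 : 0 <= k%:R * c%:R :> R by rewrite mulr_ge0 // ltW.
by rewrite ler_norml; lra.
Unshelve. all: by end_near. Qed.

Lemma cvg_ln_vk k (j : int) : k.-primitive_root (zeta R k j) ->
  (fun n => ln (vk R k j n) / n%:R ^+ 2) @ \oo -->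
  k%:R^-1 * limn (fun n => ln (v R n) / n%:R ^+ 2).
Proof.
move=> zP; have k0 : (0 < k)%N := prim_order_gt0 zP.
have kR : k%:R != 0 :> R by rewrite pnatr_eq0 -lt0n.
pose u n := ln (v R n) / n%:R ^+ 2; set L := limn _.
have uL : u @ \oo --> L := cvg_ln_v.
(* Both bounds, for c = 0 and c = 1, are written as products of convergent factors; k times k^-2
   yields the factor 1/k. *)
pose bound c n := k%:R * ((n %/ k + c)%N%:R / n%:R) ^+ 2 * u (n %/ k + c)%N.
have cvgB c : (c <= 1)%N -> bound c @ \oo --> k%:R^-1 * L.
  move=> c1; have -> : k%:R^-1 * L = k%:R * k%:R^-1 ^+ 2 * L by rewrite expr2 mulVKf.
  apply: cvgM; last first.
    have qoo : (fun n => n %/ k + c)%N @ \oo --> \oo.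
      exact: (cvg_comp _ _ (cvg_divnr k k0) (cvg_addnr c)).
    exact: (cvg_comp _ _ qoo uL).
  apply: cvgM; first exact: cvg_cst.
  by rewrite expr2; apply: cvgM; apply: cvg_divn_ratio.
apply: (squeeze_cvgr _ (cvgB 0%N isT) (cvgB 1%N isT)).
near=> n; have kn : (k <= n)%N by near: n; exact: nbhs_infty_ge.
have n0 : n%:R != 0 :> R by rewrite pnatr_eq0; lia.
have bE c : (0 < n %/ k + c)%N -> bound c n = k%:R * ln (v R (n %/ k + c)) / n%:R ^+ 2.
  move=> q0; have q0R : (n %/ k + c)%N%:R != 0 :> R by rewrite pnatr_eq0 -lt0n.
  by rewrite /bound /u; move: (_ + c)%N%:R q0R => q qN; field; rewrite qN n0.
have q0 : (0 < n %/ k)%N by rewrite divn_gt0.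
have /andP[lo up] := ln_vk_bounds zP kn.
rewrite !bE ?addn0 ?addn1 //.
by rewrite !ler_wpM2r // invr_ge0 exprn_ge0.
Unshelve. all: by end_near. Qed.
End LogValues.

Theorem theorem4p5 (R : realType) (k : nat) (j : int)
  (hk : (1 <= k)%N) (hjk : coprimez j k%:Z) :
  let a := fun n : nat => log2 (vk R k j n) / n%:R ^+ 2 in
  let b := fun n : nat => log2 (v R n) / n%:R ^+ 2 in
  [/\ cvgn a, cvgn b,
      limn a = k%:R^-1 * limn b
    & k%:R^-1 * limn b = gamma R / (k%:R * ln 2)].
Proof.
move=> a b; have zP := zeta_primitive R hk hjk.
have aE : a = (fun n => ln (vk R k j n) / n%:R ^+ 2 * (ln 2)^-1).
  by apply/funext => n; rewrite /a /log2 mulrAC.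
have bE : b = (fun n => ln (v R n) / n%:R ^+ 2 * (ln 2)^-1).
  by apply/funext => n; rewrite /b /log2 mulrAC.
have aL : a @ \oo --> k%:R^-1 * gamma R * (ln 2)^-1.
  by rewrite aE; apply: cvgM; [exact: cvg_ln_vk|exact: cvg_cst].
have bL : b @ \oo --> gamma R * (ln 2)^-1.
  by rewrite bE; apply: cvgM; [exact: cvg_ln_v|exact: cvg_cst].
split; [by apply/cvg_ex; eexists; exact: aL|by apply/cvg_ex; eexists; exact: bL| |].
- by rewrite (cvg_lim _ aL) // (cvg_lim _ bL) // mulrA.
- by rewrite (cvg_lim _ bL) // invfM mulrCA.
Qed.
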